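(* Almost all unweighted finite trees admit pair state transfer at time $\frac{\pi}{2}$ (the proportion of trees on $n$ vertices with this property tends to $1$ as $n\to\infty$). Moreover, for almost all unweighted finite trees, a single edge can be assigned weight $-1$ so that the resulting signed tree has plus state transfer at $\frac{\pi}{2}$, and a single edge can be assigned weight $-1$ so that the resulting signed tree has perfect state transfer between a pair state and a plus state at $\frac{\pi}{2}$.
   Context: For a (possibly signed) graph with adjacency matrix $A$ (entries the edge weights, all $\pm1$ here) and transition matrix $U(t)=\exp(itA)$, there is perfect state transfer between unit vectors $\mathbf u,\mathbf v$ at $\tau$ if $U(\tau)\mathbf u=\gamma\mathbf v$ for some $\gamma\in\mathbb C$. A pair state is $\frac1{\sqrt2}(\mathbf e_a-\mathbf e_b)$ and a plus state is $\frac1{\sqrt2}(\mathbf e_a+\mathbf e_b)$, $a\ne b$. Pair (resp. plus) state transfer means perfect state transfer between two pair (resp. plus) states that are not scalar multiples of each other. *)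

(* Defs.v *)
From HB Require Import structures.
From mathcomp Require Import all_boot all_order all_algebra all_fingroup complex.
From mathcomp Require Import all_classical all_reals all_analysis.
Import Order.TTheory GRing.Theory Num.Theory numFieldNormedType.Exports.

Set Implicit Arguments.
Unset Strict Implicit.
Unset Printing Implicit Defensive.

Local Open Scope classical_set_scope.
Local Open Scope ring_scope.
Local Open Scope complex_scope.

(* A graph on {0, ..., n-1} is a boolean matrix, read as a relation g x y. *)
Definition graph (n : nat) : finType := 'M[bool]_n.

(* Acyclicity: [ucycle] also accepts the empty cycle, single vertices carrying
   a loop and the closed walks x - y - x along an edge, which are not cycles of
   a graph; hence the bound 2 on the length. *)
Definition is_tree (n : nat) (g : graph n) : Prop :=
  [/\ (0 < n)%N, symmetric g /\ irreflexive g,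
      forall x y : 'I_n, connect g x y &
      forall p : seq 'I_n, ucycle g p -> (size p <= 2)%N].

Definition graph_iso (n : nat) (g h : graph n) : bool :=
  [exists s : 'S_n, [forall x, [forall y, h (s x) (s y) == g x y]]].

(* Number of isomorphism classes having a representative that satisfies P *)
Definition num_iso_classes (n : nat) (P : graph n -> Prop) : nat :=
  #|equivalence_partition (@graph_iso n) (finset (fun g => `[< P g >]))|.

(* Trees are counted up to isomorphism; the properties P of interest are
   invariant under isomorphism. *)
Definition almost_all_trees (R : realType)
    (P : forall n : nat, graph n -> Prop) : Prop :=
  (fun n : nat => (num_iso_classes (fun g : graph n => is_tree g /\ P n g))%:R
                  / (num_iso_classes (@is_tree n))%:R : R) @ \oo --> (1 : R).

Definition adjmx (R : realType) (n : nat) (g : graph n) : 'M[R]_n :=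
  \matrix_(i, j) (g i j)%:R.

(* Weighted adjacency matrix A with the edge {x, y} given weight -1 *)
Definition set_edge_neg (R : realType) (n : nat) (A : 'M[R]_n) (x y : 'I_n) :
    'M[R]_n :=
  \matrix_(i, j) if ((i == x) && (j == y)) || ((i == y) && (j == x))
                 then -1 else A i j.

Definition expmx (C : numClosedFieldType) (n : nat) (M : 'M[C]_n) : 'M[C]_n :=
  limn (series (fun k : nat => (k`!%:R : C)^-1 *: M ^+ k)).

Definition transition (R : realType) (n : nat) (A : 'M[R]_n) (t : R) :
    'M[R[i]]_n :=
  expmx (('i%C * t%:C) *: map_mx (real_complex R) A).

Definition perfect_state_transfer (R : realType) (n : nat) (A : 'M[R]_n)
    (t : R) (u v : 'cV[R[i]]_n) : Prop :=
  exists gamma : R[i], transition A t *m u = gamma *: v.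

Definition basis_vec (R : realType) (n : nat) (a : 'I_n) : 'cV[R[i]]_n :=
  delta_mx a 0.

Definition is_pair_state (R : realType) (n : nat) (u : 'cV[R[i]]_n) : Prop :=
  exists a b : 'I_n,
    a != b /\ u = (sqrtC 2)^-1 *: (basis_vec R a - basis_vec R b).

Definition is_plus_state (R : realType) (n : nat) (u : 'cV[R[i]]_n) : Prop :=
  exists a b : 'I_n,
    a != b /\ u = (sqrtC 2)^-1 *: (basis_vec R a + basis_vec R b).

Definition pair_state_transfer (R : realType) (n : nat) (A : 'M[R]_n) (t : R) :
    Prop :=
  exists u v : 'cV[R[i]]_n,
    [/\ is_pair_state u, is_pair_state v, ~ (exists c : R[i], v = c *: u)
      & perfect_state_transfer A t u v].

Definition plus_state_transfer (R : realType) (n : nat) (A : 'M[R]_n) (t : R) :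
    Prop :=
  exists u v : 'cV[R[i]]_n,
    [/\ is_plus_state u, is_plus_state v, ~ (exists c : R[i], v = c *: u)
      & perfect_state_transfer A t u v].

Definition pair_plus_transfer (R : realType) (n : nat) (A : 'M[R]_n) (t : R) :
    Prop :=
  exists u v : 'cV[R[i]]_n,
    [/\ is_pair_state u, is_plus_state v & perfect_state_transfer A t u v].

(* Main.v *)
(* A vertex w carrying two pendant paths w - a1 - a2 and w - b1 - b2 (a "limb")
   suffices: A swaps e_a1 - e_b1 and e_a2 - e_b2, so exp(i pi/2 A) acts on their
   span as i A.  Giving weight -1 to w - b1 makes A swap e_a1 + e_b1 and
   e_a2 + e_b2; giving it to b1 - b2 makes A swap e_a1 - e_b1 and e_a2 + e_b2.

   Almost all trees have a limb.  Let r_n count rooted trees and a_n those without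
   a node having two pendant-path children, up to isomorphism; a tree on n vertices
   has at most n rootings, so it suffices that n a_n / r_n -> 0.  Decomposing at
   the root, T(x) = x prod_t 1/(1 - x^|t|) over all rooted trees t, and the
   limb-free series satisfies the same equation with an extra factor 1 - x^4.
   With G(x) = prod_t exp(-x^|t|)/(1 - x^|t|), convergent beyond the radius rho
   of T, the first equation gives T(x) exp(-T(x)) = x G(x), whence
   x G(x) e <= 1 for x < rho.  Hence y (1 - y^4) G(y) e <= 1 for some
   y > rho, which by induction bounds the partial sums of the limb-free series at y
   by 1.  Finally r_m r_n <= 2 r_(m+n+1) forces r_n >= c z^-n whenever z > rho. *)

Require Import Defs.
From HB Require Import structures.
From mathcomp Require Import all_boot all_order all_algebra all_fingroup complex.
From mathcomp Require Import all_classical all_reals all_analysis.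
From mathcomp Require Import zify ring lra.
Import Order.TTheory GRing.Theory Num.Theory numFieldNormedType.Exports.
Local Open Scope ring_scope.

Set Implicit Arguments.
Unset Strict Implicit.
Unset Printing Implicit Defensive.

(** * Labelled and unlabelled rooted trees *)

Local Open Scope nat_scope.

Unset Elimination Schemes.

(** No power series or infinite product is formed. A rooted tree up to isomorphism is an unlabelled
    [rtree] whose children are sorted at every node. The series T enters only through the sums
    [wsum (ctrees N) x] over trees with at most N nodes, and convergence at x means that these sums
    are bounded. The equation for T then splits into two inequalities between finite sums and
    products. The lower one yields x G(x) e <= 1, because the supremum S of the partial sums
    satisfies x G(x) exp(S) <= S and always e S <= exp(S). The upper one, restricted to limb-free
    trees, drives the induction. The factor 1 - x^4 arises because the two-vertex branch may occur
    at most once below a node: its factor 1/(1 - x^2) becomes 1 + x^2 = (1 - x^4)/(1 - x^2). G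
    converges beyond rho because the logarithm of each of its factors is of order x^(2|t|), hence is
    governed by T(x^2), and x^2 < rho near rho since rho <= 1/2. Crossing rho is an explicit
    comparison of G at two points on either side of it. *)

Inductive ltree (T : Type) := LNode of T & seq (ltree T).
Set Elimination Schemes.

Section TreeEncoding.
Variable T : Type.

Fixpoint gentree_of_ltree (t : ltree T) : GenTree.tree T :=
  let: LNode a ts := t in
  GenTree.Node 0 (GenTree.Leaf a :: map gentree_of_ltree ts).

Fixpoint ltree_of_gentree (t : GenTree.tree T) : option (ltree T) :=
  if t is GenTree.Node _ (GenTree.Leaf a :: ts)
  then Some (LNode a (pmap ltree_of_gentree ts)) else None.

Lemma gentree_of_ltreeK : pcancel gentree_of_ltree ltree_of_gentree.
Proof.
rewrite /pcancel; fix IH 1 => -[a ts] /=; congr (Some (LNode a _)).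
by elim: ts => [|t ts IHts] //=; rewrite IH /= IHts.
Qed.
End TreeEncoding.

HB.instance Definition _ (T : eqType) := Equality.copy (ltree T)
  (pcan_type (@gentree_of_ltreeK T)).
HB.instance Definition _ (T : choiceType) := Choice.copy (ltree T)
  (pcan_type (@gentree_of_ltreeK T)).
HB.instance Definition _ (T : countType) := Countable.copy (ltree T)
  (pcan_type (@gentree_of_ltreeK T)).

Lemma ltree_ind (T : eqType) (P : ltree T -> Prop) :
  (forall a ts, {in ts, forall t, P t} -> P (LNode a ts)) -> forall t, P t.
Proof.
move=> H; fix IH 1 => -[a ts]; apply: H.
elim: ts => [|t ts IHts] u; first by clear IH.
rewrite inE => /predU1P[->|uts]; [exact: IH | exact: IHts].
Qed.

Section LabelledTrees.
Variables T U : Type.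

Definition root_label (t : ltree T) : T := let: LNode a _ := t in a.

Fixpoint labels (t : ltree T) : seq T :=
  let: LNode a ts := t in a :: flatten (map labels ts).

Definition tsize (t : ltree T) : nat := size (labels t).

Fixpoint edges (t : ltree T) : seq (T * T) :=
  let: LNode a ts := t in
  flatten [seq (a, root_label u) :: edges u | u <- ts].

Fixpoint lmap (f : T -> U) (t : ltree T) : ltree U :=
  let: LNode a ts := t in LNode (f a) (map (lmap f) ts).

Lemma tsizeE a ts :
  tsize (LNode a ts) = (\sum_(u <- ts) tsize u).+1.
Proof. by rewrite /tsize /= size_flatten sumnE !big_map. Qed.

Lemma tsize_gt0 t : 0 < tsize t. Proof. by case: t. Qed.

Lemma labels_root t : labels t = root_label t :: behead (labels t).
Proof. by case: t. Qed.

End LabelledTrees.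

Definition rtree : countType := ltree unit.
Definition shape (T : Type) (t : ltree T) : rtree := lmap (fun=> tt) t.

Section LabelledTreesTheory.
Variable T : eqType.
Implicit Types t : ltree T.

Lemma tsize_lmap (U : Type) (f : T -> U) t : tsize (lmap f t) = tsize t.
Proof.
elim/ltree_ind: t => a ts IH; rewrite !tsizeE big_map; congr _.+1.
by apply: eq_big_seq => t /IH.
Qed.

Lemma shape_lmap (U : Type) (f : T -> U) t : shape (lmap f t) = shape t.
Proof.
elim/ltree_ind: t => a ts IH; rewrite /shape /= -map_comp; congr LNode.
by apply/eq_in_map => t /IH.
Qed.

Lemma root_lmap (U : Type) (f : T -> U) t : root_label (lmap f t) = f (root_label t).
Proof. by case: t. Qed.

Lemma labels_lmap (U : Type) (f : T -> U) t : labels (lmap f t) = map f (labels t).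
Proof.
elim/ltree_ind: t => a ts IH /=; congr cons.
rewrite map_flatten -!map_comp; congr flatten.
by apply/eq_in_map => t /IH.
Qed.

Lemma edges_lmap (U : Type) (f : T -> U) t :
  edges (lmap f t) = [seq (f e.1, f e.2) | e <- edges t].
Proof.
elim/ltree_ind: t => a ts IH /=.
rewrite map_flatten -!map_comp; congr flatten.
by apply/eq_in_map => t tts /=; rewrite root_lmap IH.
Qed.

(** In preorder, each vertex other than the root is the lower end of exactly one edge. With distinct
    labels this makes parents unique. *)
Lemma edges_snd t : [seq e.2 | e <- edges t] = behead (labels t).
Proof.
elim/ltree_ind: t => a ts IH /=.
rewrite map_flatten -!map_comp; congr flatten.
by apply/eq_in_map => t tts /=; rewrite IH // -labels_root.
Qed.

Lemma root_in_labels t : root_label t \in labels t.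
Proof. by rewrite labels_root mem_head. Qed.

Lemma mem_edges_LNode a ts u v :
  ((u, v) \in edges (LNode a ts)) =
  (u == a) && (v \in map (@root_label T) ts) ||
  has (fun t => (u, v) \in edges t) ts.
Proof.
elim: ts => [|t ts IH]; first by rewrite andbF.
rewrite -[edges _]/((a, root_label t) :: edges t ++ edges (LNode a ts)).
rewrite inE mem_cat IH xpair_eqE /= inE.
by case: (u == a) => //=; case: (v == _) => //=;
  case: (_ \in edges t) => //=; rewrite ?orbT.
Qed.

Lemma mem_labels_LNode a ts u :
  (u \in labels (LNode a ts)) = (u == a) || has (fun t => u \in labels t) ts.
Proof.
rewrite /= inE; congr orb; elim: ts => [|t ts IH] //=.
by rewrite mem_cat IH.
Qed.

Lemma mem_edges_labels t u v :
  (u, v) \in edges t -> (u \in labels t) /\ (v \in behead (labels t)).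
Proof.
move=> uv; split; last by rewrite -edges_snd; apply/mapP; exists (u, v).
elim/ltree_ind: t => a ts IH in uv *; move: uv.
rewrite mem_edges_LNode mem_labels_LNode => /orP[/andP[->//]|/hasP[t tts uvt]].
by apply/orP; right; apply/hasP; exists t => //; exact: IH.
Qed.

Lemma root_notin t : uniq (labels t) -> root_label t \notin behead (labels t).
Proof. by case: t => a ts /= /andP[]. Qed.

Lemma uniq_labels_sub a ts :
  uniq (labels (LNode a ts)) ->
  {in ts, forall t, uniq (labels t) /\ a \notin labels t}.
Proof.
move=> /= /andP[aN U'] t /(nthP t)[i it <-]; split.
  elim: ts i it {aN} U' => [|s ts IH] // [|i] /= it;
    rewrite cat_uniq => /and3P[//] _ _ ?; exact: IH.
apply: contra aN => aL; apply/flattenP; exists (labels (nth t ts i)) => //.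
by apply: map_f; exact: mem_nth.
Qed.

Lemma uniq_labels_disj a ts t t' u :
  uniq (labels (LNode a ts)) -> t \in ts -> t' \in ts ->
  u \in labels t -> u \in labels t' -> t = t'.
Proof.
move=> /= /andP[_]; elim: ts => [|s ts IH] //=.
rewrite cat_uniq => /and3P[_ /hasPn dis /IH{}IH].
have key w : w \in ts -> u \in labels w -> u \notin labels s.
  by move=> wts uw; apply: dis; apply/flattenP; exists (labels w) => //; exact: map_f.
rewrite !inE => /predU1P[->|tts] /predU1P[->|t'ts] // us us'.
- by move: (key _ t'ts us'); rewrite us.
- by move: (key _ tts us); rewrite us'.
- exact: IH.
Qed.

(** [labels] is the preorder listing, in which a parent precedes its children. This orientation of
    the edges excludes loops and cycles in [realize_tree]. *)
Lemma edges_index t u v : uniq (labels t) -> (u, v) \in edges t ->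
  index u (labels t) < index v (labels t).
Proof.
elim/ltree_ind: t => a ts IH U' uv.
have [ua vb] := mem_edges_labels uv.
move: uv; rewrite mem_edges_LNode => /orP[/andP[/eqP-> _]|/hasP[t tts uvt]].
  rewrite /= eqxx; case: eqP => // av; move: vb; rewrite -av => vb.
  by move: (root_notin U'); rewrite /= vb.
have [Ut at_] := uniq_labels_sub U' tts.
have [ut vt] := mem_edges_labels uvt.
have {}vt : v \in labels t by rewrite labels_root inE vt orbT.
have na w : w \in labels t -> (a == w) = false.
  by move=> wt; apply/negbTE; apply: contra at_ => /eqP->.
rewrite /= (na u) // (na v) // ltnS.
have lt := IH _ tts Ut uvt.
move: U' => /= /andP[_].
elim: ts tts {IH ua vb} => [|s ts IHts] //=.
rewrite inE cat_uniq => /predU1P[<-|tts] /and3P[_ /hasPn dis Us].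
  by rewrite !index_cat ut vt.
have ns w : w \in labels t -> w \notin labels s.
  by move=> wt; apply: dis; apply/flattenP; exists (labels t) => //; exact: map_f.
by rewrite !index_cat (negbTE (ns _ ut)) (negbTE (ns _ vt)) ltn_add2l; exact: IHts.
Qed.

(** A shape together with its preorder word determines the labelled tree, so matching two words
    position by position carries one tree to the other. *)
Lemma lmap_of_shape t (t' : ltree T) (f : T -> T) :
  shape t = shape t' -> map f (labels t) = labels t' -> lmap f t = t'.
Proof.
elim/ltree_ind: t => a ts IH in t' *; case: t' => a' ts' /= [sh] [-> lab].
congr LNode; elim: ts => [|t ts IHts] in ts' IH sh lab *; case: ts' => [|t' ts'] // in sh lab *.
move: sh lab => /= [sht shts]; rewrite map_cat => /eqP.
rewrite eqseq_cat; last first.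
  by have := congr1 (@tsize unit) sht; rewrite !tsize_lmap size_map.
case/andP=> /eqP labt /eqP labts.
rewrite (IH t (mem_head _ _) t') //; congr cons; apply: IHts => // s sts.
by apply: IH; rewrite inE sts orbT.
Qed.

Lemma ltree_fill (t : rtree) (s : seq T) :
  size s = tsize t -> exists t', shape t' = t /\ labels t' = s.
Proof.
elim/ltree_ind: t => -[] ts IH in s *.
case: s => [|a s] //; rewrite tsizeE /= => -[sz].
suff [ts' [<- <-]] : exists ts',
    map (@shape T) ts' = ts /\ flatten (map (@labels T) ts') = s.
  by exists (LNode a ts').
elim: ts => [|t ts IHts] in s IH sz *.
  by exists [::]; move: sz; rewrite big_nil => /size0nil ->.
move: sz; rewrite big_cons => sz.
have [t' [sh lab]] := IH t (mem_head _ _) (take (tsize t) s) ltac:(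
  by rewrite size_takel // sz leq_addr).
have [|ts' [shs labs]] := IHts (drop (tsize t) s) _ ltac:(
  by rewrite size_drop sz addKn).
  by move=> u uts; apply: IH; rewrite inE uts orbT.
by exists (t' :: ts'); rewrite /= sh shs lab labs cat_take_drop.
Qed.

End LabelledTreesTheory.

(** An arbitrary total order, inherited from the countable encoding. Sorting by it at every node
    selects one plane tree in each isomorphism class of rooted trees. *)
Definition tle : rel rtree := relpre pickle leq.

Lemma tle_total : total tle. Proof. by move=> s t; exact: leq_total. Qed.
Lemma tle_trans : transitive tle. Proof. by move=> s t u; exact: leq_trans. Qed.
Lemma tle_anti : antisymmetric tle.
Proof.
move=> s t; rewrite /tle /= -eqn_leq => /eqP.
exact: (pcan_inj (@pickleK rtree)).
Qed.

Fixpoint canonical (t : rtree) : bool :=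
  let: LNode _ ts := t in sorted tle ts && all canonical ts.

(** Children are compared by shape alone, after having been sorted themselves, and carry their
    labels along; hence the set of edges does not change. *)
Fixpoint lsort (T : Type) (t : ltree T) : ltree T :=
  let: LNode a ts := t in
  LNode a (sort (relpre (@shape T) tle) (map (@lsort T) ts)).

Section Lsort.
Variable T : eqType.
Implicit Types t : ltree T.

Lemma root_lsort t : root_label (lsort t) = root_label t.
Proof. by case: t. Qed.

Lemma canonical_lsort t : canonical (shape (lsort t)).
Proof.
elim/ltree_ind: t => a ts IH /=; apply/andP; split.
  rewrite -[map _ _]sort_map; exact: (sort_sorted tle_total).
rewrite all_map all_sort all_map; apply/allP => t /IH //.
Qed.

Lemma labels_lsort t : perm_eq (labels (lsort t)) (labels t).
Proof.
elim/ltree_ind: t => a ts IH /=; rewrite perm_cons.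
apply: (@perm_trans _ (flatten (map (@labels T) (map (@lsort T) ts)))).
  by apply: perm_flatten; apply: perm_map; rewrite perm_sort.
elim: ts IH => [|t ts IHts] IH //=; apply: perm_cat; first by apply: IH; rewrite mem_head.
by apply: IHts => u uts; apply: IH; rewrite inE uts orbT.
Qed.

Lemma edges_lsort t u v : ((u, v) \in edges (lsort t)) = ((u, v) \in edges t).
Proof.
elim/ltree_ind: t => a ts IH; rewrite [lsort _]/= !mem_edges_LNode.
rewrite (perm_has _ (permEl (perm_sort _ _))) has_map; congr ((_ && _) || _);
  last by apply: eq_in_has => t /IH.
rewrite (perm_mem (perm_map _ (permEl (perm_sort _ _)))) -map_comp.
by congr (_ \in _); apply: eq_map => t /=; rewrite root_lsort.
Qed.

End Lsort.

Local Open Scope ring_scope.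

(** * Tree graphs and their spanning labelled trees *)

Local Open Scope nat_scope.

Definition spans (n : nat) (g : graph n) (t : ltree 'I_n) : Prop :=
  perm_eq (labels t) (enum 'I_n) /\
  forall u v, g u v = ((u, v) \in edges t) || ((v, u) \in edges t).

(** The leaf is attached at every node labelled [u]; when labels are distinct there is at most one
    such node. *)
Fixpoint graft (T : eqType) (u v : T) (t : ltree T) : ltree T :=
  let: LNode a ts := t in
  LNode a (if a == u then LNode v [::] :: map (graft u v) ts
           else map (graft u v) ts).

Section Graft.
Variables (T : eqType) (u v : T).
Implicit Types t : ltree T.

Lemma root_graft t : root_label (graft u v t) = root_label t.
Proof. by case: t. Qed.

Lemma labels_graft t :
  perm_eq (labels (graft u v t)) (nseq (count_mem u (labels t)) v ++ labels t).
Proof.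
elim/ltree_ind: t => a ts IH.
have H : perm_eq (flatten (map (@labels T) (map (graft u v) ts)))
    (nseq (count_mem u (flatten (map (@labels T) ts))) v ++
     flatten (map (@labels T) ts)).
  elim: ts IH => [|t ts IHts] IH //=.
  rewrite count_cat nseqD -catA.
  apply: (perm_trans (perm_cat (IH t (mem_head _ _)) (IHts _))).
    by move=> s sts; apply: IH; rewrite inE sts orbT.
  by rewrite -!catA perm_cat2l perm_catCA.
move/seq.permP: H => H; apply/seq.permP => p; rewrite /= count_cat.
case: (a == u); rewrite /= H count_cat ?add0n ?add1n /=;
  by move: (count p (nseq _ _)) (count p (flatten _)) => c d; lia.
Qed.

Lemma edges_graft t e : (e \in edges (graft u v t)) =
  (e == (u, v)) && (u \in labels t) || (e \in edges t).
Proof.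
case: e => w z; elim/ltree_ind: t => a ts IH.
have H : has (fun t => (w, z) \in edges t) (map (graft u v) ts) =
    ((w, z) == (u, v)) && has (fun t => u \in labels t) ts ||
    has (fun t => (w, z) \in edges t) ts.
  rewrite has_map; elim: ts IH => [|t ts IHts] IH; first by rewrite andbF.
  rewrite /= IH ?mem_head // IHts; last first.
    by move=> s sts; apply: IH; rewrite inE sts orbT.
  by case: (_ == (u, v)); case: (u \in labels t); case: (_ \in edges t);
    rewrite /= ?orbT.
have R : map (@root_label T) (map (graft u v) ts) = map (@root_label T) ts.
  by rewrite -map_comp; apply: eq_map => t /=; rewrite root_graft.
rewrite [graft _ _ _]/= !mem_edges_LNode mem_labels_LNode.
case: (altP (a =P u)) => [->|au].
  rewrite /= H R inE eqxx xpair_eqE andbT.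
  by case: (w == u); case: (z == v); rewrite /= ?orbT //; case: (z \in _).
by rewrite H R (eq_sym u) (negbTE au) /= orbCA.
Qed.

End Graft.

Lemma connect_root (T : finType) (t : ltree T) (e : rel T) :
  (forall a b, (a, b) \in edges t -> e a b) ->
  forall v, v \in labels t -> connect e (root_label t) v.
Proof.
elim/ltree_ind: t => a ts IH sub v; rewrite mem_labels_LNode.
case/predU1P=> [->|/hasP[t tts vt]]; first exact: connect0.
apply: (@connect_trans _ _ (root_label t)).
  by apply/connect1/sub; rewrite mem_edges_LNode eqxx map_f.
apply: IH => // b c bc; apply: sub; rewrite mem_edges_LNode.
by apply/orP; right; apply/hasP; exists t.
Qed.

Section TreeGraphs.
Variable n : nat.
Implicit Types (g h : graph n) (t : ltree 'I_n).

(** The subtree grows from [x] one vertex at a time: a proper vertex set containing [x] that no edge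
    leaves would contradict connectedness. *)
Lemma subtree_of_tree g (x : 'I_n) (k : nat) : is_tree g -> k < n ->
  exists t, [/\ root_label t = x, uniq (labels t), tsize t = k.+1 &
    forall u v, (u, v) \in edges t -> g u v].
Proof.
move=> [_ [gsym _] gconn _]; elim: k => [|k IH] kn.
  by exists (LNode x [::]).
have [t [rx Ut sz sub]] := IH (ltnW kn).
have [v vt] : exists v, v \notin labels t.
  apply/existsP; rewrite -[[exists _, _]]negbK negb_exists.
  apply/negP => /forallP all_t.
  have := @uniq_leq_size _ (enum 'I_n) (labels t) (enum_uniq _).
  rewrite size_enum_ord -/(tsize t) sz leqNgt kn => H.
  suff : ~~ true by [].
  by apply: H => y _; move: (all_t y); rewrite negbK.
have [a [b [at_ bt gab]]] : exists a b, [/\ a \in labels t, b \notin labels t & g a b].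
  have [/existsP[a /existsP[b /and3P[]]]|N] :=
      boolP [exists a, exists b, [&& a \in labels t, b \notin labels t & g a b]].
    by exists a, b.
  have cl : fingraph.closed g (mem (labels t)).
    apply: (intro_closed (sym_connect_sym gsym)) => y z gyz yt.
    move: N; rewrite negb_exists => /forallP/(_ y); rewrite negb_exists.
    by move=> /forallP/(_ z); rewrite yt gyz andbT negbK.
  have := closed_connect cl (gconn x v).
  move=> H; have : (x \in labels t) = (v \in labels t) by exact: H.
  by rewrite (negbTE vt) -rx root_in_labels.
exists (graft a b t); split.
- by rewrite root_graft.
- rewrite (perm_uniq (labels_graft _ _ _)) (count_uniq_mem _ Ut) at_ /=.
  by rewrite bt.
- rewrite /tsize (perm_size (labels_graft _ _ _)) (count_uniq_mem _ Ut) at_ /=.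
  by rewrite -/(tsize t) sz.
- by move=> y z; rewrite edges_graft => /orP[/andP[/eqP[-> ->]]|/sub].
Qed.

(** An edge of [g] missing from the spanning tree would close the simple tree path between its ends
    into a cycle of length at least 3. *)
Lemma spans_exists g (x : 'I_n) : is_tree g ->
  exists t, [/\ root_label t = x, canonical (shape t) & spans g t].
Proof.
move=> gT; have [_ [gsym girr] gconn gcyc] := gT.
have n0 : 0 < n by case: (n) x => [[]|].
have [t [rx Ut sz sub]] := subtree_of_tree x gT (ltac:(by rewrite prednK) : n.-1 < n).
rewrite prednK // in sz.
have all_t : labels t =i enum 'I_n.
  have sub' : {subset labels t <= enum 'I_n} by move=> y _; rewrite mem_enum.
  have [|//] := uniq_min_size Ut sub'.
  by rewrite size_enum_ord -/(tsize t) sz.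
have tP : forall u v, g u v = ((u, v) \in edges t) || ((v, u) \in edges t).
  move=> u v; apply/idP/idP; last first.
    by case/orP=> /sub //; rewrite gsym.
  move=> guv; apply: contraT => N.
  pose e := [rel a b | ((a, b) \in edges t) || ((b, a) \in edges t)].
  have esym : symmetric e by move=> a b; rewrite /= orbC.
  have ec a : connect e (root_label t) a.
    apply: connect_root => [b c bc|]; first by rewrite /= bc.
    by rewrite all_t mem_enum.
  have /connectP[p] : connect e v u.
    by apply: connect_trans (ec u); rewrite (sym_connect_sym esym) ec.
  move=> /shortenP[q vq Uq _ lq].
  have subp : subrel e g by move=> a b /orP[/sub//|/sub]; rewrite gsym.
  have : ucycle g (v :: q).
    by rewrite /ucycle Uq /= rcons_path (sub_path subp vq) -lq guv.
  move/gcyc; case: q vq lq {Uq} => [|b [|c q]] //=.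
    by move=> _ uv; move: guv; rewrite uv girr.
  by rewrite andbT => vb bu; move: N; rewrite bu orbC vb.
exists (lsort t); split; [by rewrite root_lsort | exact: canonical_lsort |].
split; last by move=> u v; rewrite !edges_lsort.
apply: perm_trans (labels_lsort t) _.
by apply: uniq_perm => //; exact: enum_uniq.
Qed.

Lemma spans_uniq g t : spans g t -> uniq (labels t).
Proof. by case=> /perm_uniq-> _; exact: enum_uniq. Qed.

Lemma spans_mem g t u : spans g t -> u \in labels t.
Proof. by case=> /perm_mem-> _; rewrite mem_enum. Qed.

Lemma spans_tsize g t : spans g t -> tsize t = n.
Proof. by case=> /perm_size; rewrite size_enum_ord. Qed.

Lemma spans_lmap g h t (s : 'S_n) :
  (forall x y, h (s x) (s y) = g x y) -> spans g t -> spans h (lmap s t).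
Proof.
move=> gh gt; have [_ gE] := gt; split.
  apply: uniq_perm (enum_uniq _) _.
    by rewrite labels_lmap map_inj_uniq; [exact: spans_uniq gt | exact: perm_inj].
  move=> x; rewrite mem_enum labels_lmap -(permKV s x) mem_map; last exact: perm_inj.
  by rewrite (spans_mem _ gt).
move=> u v; rewrite -(permKV s u) -(permKV s v) gh gE edges_lmap.
have I : injective (fun e : 'I_n * 'I_n => (s e.1, s e.2)).
  by move=> [a b] [c d] /= [/perm_inj-> /perm_inj->].
by congr (_ || _); rewrite -(mem_map I).
Qed.

(** The isomorphism matches vertices at equal positions in the two preorder listings. *)
Lemma spans_iso g h t t' :
  spans g t -> spans h t' -> shape t = shape t' -> graph_iso g h.
Proof.
move=> gt ht' sh.
have Ut := spans_uniq gt; have Ut' := spans_uniq ht'.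
have sz := spans_tsize gt; have sz' := spans_tsize ht'.
pose f x := nth x (labels t') (index x (labels t)).
have ix x : index x (labels t) < n.
  by have := spans_mem x gt; rewrite -index_mem -/(tsize t) sz.
have finj : injective f.
  move=> x y; rewrite /f (set_nth_default y) ?[size _]sz' ?ix // => /eqP.
  rewrite nth_uniq ?[size _]sz' ?ix // => /eqP.
  move=> e; rewrite -(nth_index x (spans_mem x gt)) e nth_index //.
  exact: spans_mem gt.
have ft : map f (labels t) = labels t'.
  have ssz : size (labels t) = size (labels t') by rewrite [LHS]sz [RHS]sz'.
  case E : (labels t) => [|x0 s0].
    by case: (labels t') ssz => //; rewrite E.
  rewrite -E; apply: (@eq_from_nth _ x0); first by rewrite size_map.
  move=> i; rewrite size_map => i_lt; rewrite (nth_map x0) // /f index_uniq //.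
  by apply: set_nth_default; rewrite -ssz.
have mt : lmap f t = t' := lmap_of_shape sh ft.
apply/existsP; exists (perm finj); apply/forallP => x; apply/forallP => y.
have [_ gE] := gt; have [_ hE] := ht'.
rewrite !permE gE hE -mt edges_lmap.
have I : injective (fun e : 'I_n * 'I_n => (f e.1, f e.2)).
  by move=> [a b] [c d] /= [/finj-> /finj->].
by apply/eqP; congr (_ || _); rewrite -[RHS](mem_map I).
Qed.

(** On a cycle of length at least 3, the vertex latest in preorder would have both cyclic neighbours
    as parents. Parents being unique, its successor and predecessor would coincide. *)
Lemma realize_tree (t : rtree) : tsize t = n ->
  exists g t', [/\ is_tree g, spans g t' & shape t' = t].
Proof.
move=> szt; have [|t' [sh lab]] := @ltree_fill 'I_n t (enum 'I_n).
  by rewrite size_enum_ord.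
pose g : graph n :=
  (\matrix_(u, v) (((u, v) \in edges t') || ((v, u) \in edges t')))%R.
have gE u v : g u v = ((u, v) \in edges t') || ((v, u) \in edges t').
  by rewrite mxE.
have Ut : uniq (labels t') by rewrite lab enum_uniq.
have gt : spans g t' by split=> //; rewrite lab.
have gsym : symmetric g by move=> u v; rewrite !gE orbC.
exists g, t'; split=> //; split.
- by rewrite -szt tsize_gt0.
- split=> // u; rewrite gE orbb; apply/negP => /(edges_index Ut).
  by rewrite ltnn.
- have gc u : connect g (root_label t') u.
    apply: connect_root => [a b ab|]; first by rewrite gE ab.
    exact: spans_mem gt.
  move=> u v; apply: connect_trans (gc v).
  by rewrite (sym_connect_sym gsym) gc.
- move=> p /andP[cp Up]; rewrite leqNgt; apply/negP => szp.
  have [w0 w0p] : exists w, w \in p.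
    by case: (p) szp => // w q _; exists w; rewrite mem_head.
  pose w := [arg max_(w > w0 in p) index w (labels t')].
  have [wp wmax] : w \in p /\ forall y, y \in p ->
      index y (labels t') <= index w (labels t').
    by rewrite /w; case: arg_maxnP => // y yp ymax; split=> // z /ymax.
  have par y : y \in p -> g y w -> (y, w) \in edges t'.
    move=> yp; rewrite gE => /orP[//|/(edges_index Ut)].
    by rewrite ltnNge wmax.
  have nw : (next p w, w) \in edges t'.
    by apply: par; rewrite ?mem_next // gsym; exact: next_cycle cp wp.
  have pw : (prev p w, w) \in edges t'.
    by apply: par; rewrite ?mem_prev //; exact: prev_cycle cp wp.
  have Ue : uniq (map snd (edges t')).
    by rewrite edges_snd; case: (t') Ut => a ts /= /andP[].
  have npw : next p w = prev p w.
    suff : (next p w, w) = (prev p w, w) by case.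
    move: Ue nw pw; elim: (edges t') => // e es IH /= /andP[eN /IH{}IH].
    rewrite !inE => /predU1P[ne|ne] /predU1P[pe|pe].
    + by rewrite ne pe.
    + by case/negP: eN; apply/mapP; exists (prev p w, w); rewrite // -ne.
    + by case/negP: eN; apply/mapP; exists (next p w, w); rewrite // -pe.
    + exact: IH.
  (* With the cycle rotated to start at [w], the successor is its second entry and the predecessor
     its last one; these differ as there are at least three distinct entries. *)
  have [i q rq] := rot_to wp.
  have := npw; rewrite -(next_rot i Up) -(prev_rot i Up) rq.
  have := szp; rewrite -(size_rot i) rq.
  have : uniq (w :: q) by rewrite -rq rot_uniq.
  case: q {rq} => [|a [|b q]] //= /and3P[wN aN _] _.
  have prev_last c r : w \notin c :: r -> prev_at w w c r = last c r.
    elim: r c => [|d r IH] c; first by rewrite /= eqxx.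
    rewrite inE negb_or => /andP[_ wdr].
    have := wdr; rewrite inE negb_or => /andP[wd _].
    by rewrite /= (negbTE wd) IH.
  have /norP[wa wbq] := wN.
  have /norP[wb _] := wbq.
  rewrite eqxx (negbTE wa) (negbTE wb) prev_last // => ab.
  by move: aN; rewrite {1}ab mem_last.
Qed.

End TreeGraphs.

Local Open Scope ring_scope.

(** * Rootings read off the graph, and limbs *)

Local Open Scope nat_scope.

(* A condition local to each node, so that it can be used by induction on the
   tree; [p] is the parent of the root. *)
Fixpoint children_ok (n : nat) (g : graph n) (p : option 'I_n)
    (t : ltree 'I_n) : bool :=
  let: LNode u ts := t in
  perm_eq (map (@root_label _) ts)
          [seq v <- enum 'I_n | g u v && (Some v != p)] &&
  all (children_ok g (Some u)) ts.

Definition pendant_P2 : rtree := LNode tt [:: LNode tt [::]].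

(** Only limbs with both branches below the node are seen, not those using the branch through the
    parent. This can only enlarge the class shown to be negligible. *)
Fixpoint limb_free (t : rtree) : bool :=
  let: LNode _ ts := t in
  (count_mem pendant_P2 ts <= 1) && all limb_free ts.

Definition has_limb (n : nat) (g : graph n) : Prop :=
  exists w a1 a2 b1 b2 : 'I_n,
    [/\ uniq [:: w; a1; a2; b1; b2],
        forall v, g a1 v = (v == w) || (v == a2), forall v, g a2 v = (v == a1),
        forall v, g b1 v = (v == w) || (v == b2) & forall v, g b2 v = (v == b1)].

Section ChildrenOk.
Variables (n : nat) (g : graph n).
Implicit Types t : ltree 'I_n.

(** The hypotheses describe a subtree attached through its root to [p]: the edge to [p] is the only
    adjacency that [edges t] does not record. Unlike [spans], this form passes to the children. *)
Lemma children_ok_edges t p : uniq (labels t) ->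
  (forall v, v \in labels t -> Some v != p) ->
  (forall u v, u \in labels t -> g u v =
    [|| (u, v) \in edges t, (v, u) \in edges t | (u == root_label t) && (Some v == p)]) ->
  children_ok g p t.
Proof.
elim/ltree_ind: t => a ts IH in p *; move=> Ut pN gE /=.
have aB : a \notin behead (labels (LNode a ts)) := root_notin Ut.
have eR v : ((a, v) \in edges (LNode a ts)) = (v \in map (@root_label _) ts).
  rewrite mem_edges_LNode eqxx /= orbC; case: hasP => // -[t tts].
  case/mem_edges_labels => aL; have [_] := uniq_labels_sub Ut tts.
  by rewrite aL.
have eL v : ((v, a) \in edges (LNode a ts)) = false.
  by apply/negP => /mem_edges_labels[_]; rewrite (negbTE aB).
apply/andP; split.
  apply: uniq_perm; [| exact: filter_uniq (enum_uniq _) |].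
    have : uniq (map snd (edges (LNode a ts))).
      by rewrite edges_snd; case/andP: Ut.
    apply: subseq_uniq => /=; elim: (ts) => [|t us IHus] //=.
    rewrite eqxx map_cat; apply: subseq_trans IHus _; exact: suffix_subseq.
  move=> v; rewrite mem_filter mem_enum andbT gE ?mem_head //.
  rewrite eR eL /= eqxx /=.
  have [vts|_] := boolP (v \in _) => /=; last by case: (_ == p).
  rewrite pN // mem_labels_LNode; apply/orP; right.
  by case/mapP: vts => t tts ->; apply/hasP; exists t => //; exact: root_in_labels.
apply/allP => t tts; have [Ut' at_] := uniq_labels_sub Ut tts.
apply: (IH t tts) => // [v vt|u v ut].
  by apply: contra at_ => /eqP[<-].
have uL : u \in labels (LNode a ts).
  by rewrite mem_labels_LNode; apply/orP; right; apply/hasP; exists t.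
have ua : u != a by apply: contra at_ => /eqP<-.
rewrite gE // [_ == root_label (LNode a ts)](negbTE ua) /= orbF.
have e1 w : ((u, w) \in edges (LNode a ts)) = ((u, w) \in edges t).
  rewrite mem_edges_LNode (negbTE ua) /=; apply/hasP/idP => [[s sts us]|]; last by exists t.
  have [us' _] := mem_edges_labels us.
  by rewrite (uniq_labels_disj Ut tts sts ut us').
have e2 w : ((w, u) \in edges (LNode a ts)) =
    ((w, u) \in edges t) || (u == root_label t) && (w == a).
  rewrite mem_edges_LNode; apply/orP/orP.
    case=> [/andP[-> /mapP[s sts us]]|/hasP[s sts us]].
      right; rewrite andbT us; apply/eqP; congr root_label; apply/esym.
      by apply: (uniq_labels_disj Ut tts sts ut); rewrite us root_in_labels.
    left; have [_ us'] := mem_edges_labels us.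
    rewrite (uniq_labels_disj Ut tts sts ut) //.
    by rewrite labels_root inE us' orbT.
  case=> [wu|/andP[/eqP-> ->]]; last by left; rewrite map_f.
  by right; apply/hasP; exists t.
by rewrite e1 e2 -(inj_eq (@Some_inj _)).
Qed.

Lemma children_ok_spans t : spans g t -> children_ok g None t.
Proof.
move=> gt; apply: children_ok_edges => //; first exact: spans_uniq gt.
by move=> u v _; rewrite gt.2 andbF orbF.
Qed.

(** The graph and the root determine the set of children at every node, and sorting removes the
    remaining freedom. Thus a graph with a chosen root has a single canonical shape. *)
Lemma children_ok_shape p t t' : children_ok g p t -> children_ok g p t' ->
  root_label t = root_label t' ->
  canonical (shape t) -> canonical (shape t') -> shape t = shape t'.
Proof.
elim/ltree_ind: t => a ts IH in p t' *; case: t' => a' ts' /=.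
move=> /andP[pe /allP ok] /andP[pe' /allP ok'] aa'; rewrite -{a'}aa' in pe' ok' *.
move=> /andP[so /allP ca] /andP[so' /allP ca'].
rewrite /shape /=; congr LNode.
apply: (sorted_eq tle_trans tle_anti so so').
have {pe pe'} : perm_eq (map (@root_label _) ts) (map (@root_label _) ts').
  by rewrite (permPl pe) perm_sym.
have {}ca t : t \in ts -> canonical (shape t) by move=> tts; apply: ca; apply: map_f.
have {}ca' t : t \in ts' -> canonical (shape t) by move=> tts; apply: ca'; apply: map_f.
move=> {so so'}; elim: ts => [|t ts IHts] in ts' IH ok ok' ca ca' *.
  by move/perm_size; rewrite !size_map => /esym/size0nil->.
move=> pe.
have /mapP[t' tts' rt] : root_label t \in map (@root_label _) ts'.
  by rewrite -(perm_mem pe) mem_head.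
have pt' := perm_to_rem tts'.
rewrite (permPr (perm_map _ pt')) /=.
have -> : lmap (fun=> tt) t = lmap (fun=> tt) t'.
  have tts := mem_head t ts.
  exact: (IH t tts _ _ (ok t tts) (ok' t' tts') rt (ca t tts) (ca' t' tts')).
rewrite perm_cons; apply: IHts.
- by move=> s sts; apply: IH; rewrite inE sts orbT.
- by move=> s sts; apply: ok; rewrite inE sts orbT.
- by move=> s /mem_rem; exact: ok'.
- by move=> s sts; apply: ca; rewrite inE sts orbT.
- by move=> s /mem_rem; exact: ca'.
- by move: pe; rewrite (permPr (perm_map _ pt')) /= rt perm_cons.
Qed.

Lemma children_ok_limb p t : symmetric g -> irreflexive g ->
  children_ok g p t -> ~~ limb_free (shape t) -> has_limb g.
Proof.
move=> gsym girr; elim/ltree_ind: t => u ts IH in p *.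
move=> /= /andP[pe /allP ok]; rewrite negb_and -ltnNge => /orP[]; last first.
  rewrite all_map -has_predC => /hasP[t tts]; exact: IH (ok t tts).
rewrite count_map -size_filter.
(* The roots of the children are distinct neighbours of [u], so two branches of shape [pendant_P2]
   start at different vertices. *)
have : uniq (map (@root_label _) [seq t <- ts | shape t == pendant_P2]).
  apply: (@subseq_uniq _ _ (map (@root_label _) ts)).
    by apply: map_subseq; exact: filter_subseq.
  by rewrite (perm_uniq pe); exact: filter_uniq (enum_uniq _).
have inc t : t \in [seq t <- ts | shape t == pendant_P2] ->
   shape t = pendant_P2 /\ t \in ts.
  by rewrite mem_filter => /andP[/eqP].
have limb t : shape t = pendant_P2 -> t \in ts -> exists a2,
    (forall v, g (root_label t) v = (v == u) || (v == a2)) /\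
    (forall v, g a2 v = (v == root_label t)).
  case: t => a1 [|[a2 [|? ?]] [|? ?]] // _ tts; exists a2.
  have gu : g a1 u.
    have : a1 \in map (@root_label _) ts by apply/mapP; exists (LNode a1 [:: LNode a2 [::]]).
    by rewrite (perm_mem pe) mem_filter gsym => /andP[/andP[]].
  have := ok _ tts; rewrite /= !andbT => /andP[pe1 pe2]; split=> v.
    have := perm_mem pe1 v; rewrite inE mem_filter mem_enum andbT => ->.
    by rewrite (inj_eq (@Some_inj _)); case: eqP => [->|]; rewrite ?gu ?andbT.
  have g21 : g a2 a1.
    have := perm_mem pe1 a2; rewrite mem_head mem_filter gsym.
    by move=> /esym/andP[/andP[]].
  have := perm_mem pe2 v; rewrite in_nil mem_filter mem_enum andbT.
  rewrite (inj_eq (@Some_inj _)); case: eqP => [->|]; first by rewrite g21.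
  by rewrite andbT => _ <-.
rewrite -[X in 1 < size X -> _]/[seq t <- ts | shape t == pendant_P2].
case: [seq t <- ts | shape t == pendant_P2] inc => [|s [|t r]] // inc.
rewrite [X in X -> _]/=.
rewrite inE negb_or => /andP[/andP[st _] _] _.
have [|ss sts] := inc s; first by rewrite mem_head.
have [|ts' tts] := inc t; first by rewrite !inE eqxx orbT.
have [a2 [g1 g2]] := limb _ ss sts; have [b2 [h1 h2]] := limb _ ts' tts.
exists u, (root_label s), a2, (root_label t), b2; split => //.
move: (root_label s) (root_label t) st g1 g2 h1 h2 => a1 b1 ab g1 g2 h1 h2.
(* Adjacent vertices differ by irreflexivity; the other pairs are told apart by their
   neighbourhoods. *)
have ne x y : g x y -> (x == y) = false.
  by apply: contraTF => /eqP->; rewrite girr.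
have ua1 : (u == a1) = false by apply: ne; rewrite gsym g1 eqxx.
have ub1 : (u == b1) = false by apply: ne; rewrite gsym h1 eqxx.
have a12 : (a1 == a2) = false by apply: ne; rewrite g1 eqxx orbT.
have b12 : (b1 == b2) = false by apply: ne; rewrite h1 eqxx orbT.
have ua2 : (u == a2) = false.
  apply: contraNF ab => /eqP ua; rewrite eq_sym -g2 -ua gsym h1 eqxx //.
have ub2 : (u == b2) = false.
  by apply: contraNF ab => /eqP ub; rewrite -h2 -ub gsym g1 eqxx.
have a1b2 : (a1 == b2) = false.
  by apply/negP => /eqP E; move: (h2 u); rewrite -E g1 eqxx ub1.
have a2b1 : (a2 == b1) = false.
  by apply/negP => /eqP E; move: (h1 u); rewrite -E g2 eqxx ua1.
have a2b2 : (a2 == b2) = false.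
  by apply/negP => /eqP E; move: (h2 a1); rewrite -E g2 eqxx (negbTE ab).
by rewrite /= !inE ua1 ua2 ub1 ub2 a12 (negbTE ab) a1b2 a2b1 a2b2 b12.
Qed.

End ChildrenOk.

Local Open Scope ring_scope.

(** * Counting rooted trees *)

Local Open Scope nat_scope.

Fixpoint words (T : Type) (s : seq T) (k : nat) : seq (seq T) :=
  if k is k'.+1 then [::] :: [seq x :: w | x <- s, w <- words s k']
  else [:: [::]].

Lemma mem_words (T : eqType) (s w : seq T) k :
  size w <= k -> {subset w <= s} -> w \in words s k.
Proof.
elim: k w => [|k IH] [|x w] //= wk ws.
rewrite inE /=; apply/allpairsP; exists (x, w); split=> //=.
  by apply: ws; rewrite mem_head.
by apply: IH => // y yw; apply: ws; rewrite inE yw orbT.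
Qed.

(** Merely a finite list containing all trees with at most [N] nodes, possibly with larger ones;
    [ctrees] filters it. *)
Fixpoint rtrees (N : nat) : seq rtree :=
  if N is N'.+1 then map (LNode tt) (words (rtrees N') N') else [::].

Lemma size_children_lt a (ts : seq rtree) : size ts < tsize (LNode a ts).
Proof.
rewrite tsizeE ltnS -sum1_size [X in _ <= X]big_seq big_seq.
by apply: leq_sum => t _; exact: tsize_gt0.
Qed.

Lemma tsize_child_lt a (ts : seq rtree) t : t \in ts -> tsize t < tsize (LNode a ts).
Proof. by move=> tts; rewrite tsizeE ltnS (big_rem t) //= leq_addr. Qed.

Lemma mem_rtrees (t : rtree) N : tsize t <= N -> t \in rtrees N.
Proof.
elim: N t => [|N IH] [[] ts] // tN.
apply: map_f; apply: mem_words.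
  by have := leq_trans (size_children_lt tt ts) tN.
by move=> t tts; apply: IH; have := leq_trans (tsize_child_lt tt tts) tN.
Qed.

Definition ctrees (N : nat) : seq rtree :=
  undup [seq t <- rtrees N | canonical t & tsize t <= N].

Lemma ctrees_uniq N : uniq (ctrees N). Proof. exact: undup_uniq. Qed.

Lemma mem_ctrees N t : (t \in ctrees N) = canonical t && (tsize t <= N).
Proof.
rewrite mem_undup mem_filter; apply: andb_idr => /andP[_].
exact: mem_rtrees.
Qed.

Definition lftrees (N : nat) : seq rtree := [seq t <- ctrees N | limb_free t].

Lemma lftrees_uniq N : uniq (lftrees N).
Proof. exact/filter_uniq/ctrees_uniq. Qed.

Lemma mem_lftrees N t :
  (t \in lftrees N) = [&& limb_free t, canonical t & tsize t <= N].
Proof. by rewrite mem_filter mem_ctrees. Qed.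

(** * Multisets of children as multiplicity functions *)

Section Multisets.
Variables (s : seq rtree) (M : nat).
Hypothesis Us : uniq s.
Implicit Types f : {ffun 'I_(size s) -> 'I_M.+1}.

(** Encoding multiplicities by a finite function matches the index set obtained by expanding a
    product of sums. *)
Definition children_of f : seq rtree :=
  flatten [seq nseq (f i) (tnth (in_tuple s) i) | i <- enum 'I_(size s)].

Definition node_of f : rtree := LNode tt (sort tle (children_of f)).

Lemma tsize_node_of f :
  tsize (node_of f) = (\sum_i f i * tsize (tnth (in_tuple s) i)).+1.
Proof.
rewrite tsizeE (perm_big _ (permEl (perm_sort _ _))) /= big_flatten big_map.
rewrite big_enum; congr _.+1; apply: eq_bigr => i _.
by rewrite big_nseq iter_addn addn0 mulnC.
Qed.

Lemma count_children_of f i :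
  count_mem (tnth (in_tuple s) i) (children_of f) = f i.
Proof.
rewrite /children_of count_flatten -map_comp sumnE big_map big_enum.
rewrite (bigD1 i) //= count_nseq /= eqxx mul1n big1 ?addn0 // => j ji.
rewrite count_nseq /=; have : injective (tnth (in_tuple s)) by apply/tuple_uniqP.
by move/inj_eq ->; rewrite (negbTE ji).
Qed.

Lemma node_of_inj : injective node_of.
Proof.
move=> f f' [/(perm_sortP tle_total tle_trans tle_anti)/seq.permP E].
by apply/ffunP => i; apply/val_inj; rewrite /= -!count_children_of E.
Qed.

Lemma canonical_node_of f : all canonical s -> canonical (node_of f).
Proof.
move=> /allP cs; rewrite /= sort_sorted ?all_sort; last exact: tle_total.
apply/allP => t /flattenP[w /mapP[i _ ->]]; rewrite mem_nseq => /andP[_ /eqP->].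
exact/cs/mem_tnth.
Qed.

Lemma node_of_surj (ts : seq rtree) : canonical (LNode tt ts) ->
  {subset ts <= s} -> (forall t, count_mem t ts <= M) ->
  node_of [ffun i => inord (count_mem (tnth (in_tuple s) i) ts)] = LNode tt ts.
Proof.
move=> /= /andP[so _] sub cM; congr LNode.
apply: (sorted_eq tle_trans tle_anti (sort_sorted tle_total _) so).
rewrite perm_sort; apply/allP => t; rewrite mem_cat => tin /=.
have ts_ : t \in s.
  case/orP: tin => [|/sub//].
  by case/flattenP=> w /mapP[i _ ->]; rewrite mem_nseq => /andP[_ /eqP->]; exact: mem_tnth.
have [i ->] := tnthP (in_tuple s) t ts_.
by rewrite count_children_of ffunE inordK // ltnS.
Qed.

End Multisets.

Local Open Scope ring_scope.

(** * The functional equation as two inequalities between finite sums *)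

Section GeneratingFunctions.
Variable R : realFieldType.
Implicit Types x y : R.

Lemma ler_sum_subset (I : eqType) (s1 s2 : seq I) (F : I -> R) :
  uniq s1 -> {subset s1 <= s2} -> (forall i, 0 <= F i) ->
  \sum_(i <- s1) F i <= \sum_(i <- s2) F i.
Proof.
move=> U1 sub F0; elim: s1 s2 U1 sub => [|a s1 IH] s2 /=.
  by move=> _ _; rewrite big_nil sumr_ge0.
move=> /andP[aN U1] sub; have a2 : a \in s2 by apply: sub; rewrite mem_head.
rewrite big_cons (big_rem a a2) /= lerD2l; apply: IH => // b bs.
have : b \in s2 by apply: sub; rewrite inE bs orbT.
rewrite (perm_mem (perm_to_rem a2)) inE => /predU1P[ba|//].
by rewrite ba (negbTE aN) in bs.
Qed.

(** On [ctrees N] this is the truncation of T at degree N. *)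
Definition wsum (s : seq rtree) (x : R) : R := \sum_(t <- s) x ^+ tsize t.

(** Each term of the expanded product is the monomial of one canonical tree [node_of f], and
    distinct [f] give distinct trees; [K] is the largest size that occurs. *)
Lemma wsum_ctrees_ge (s : seq rtree) (M : nat) x : 0 <= x -> uniq s ->
  all canonical s -> exists K,
  x * \prod_(t <- s) \sum_(j < M.+1) x ^+ (j * tsize t) <= wsum (ctrees K) x.
Proof.
move=> x0 Us cs.
pose K := (\max_(f : {ffun 'I_(size s) -> 'I_M.+1}) tsize (node_of f))%N.
exists K; rewrite big_tnth bigA_distr_bigA big_distrr /=.
have -> : \sum_(f : {ffun 'I_(size s) -> 'I_M.+1})
    x * \prod_i x ^+ (f i * tsize (tnth (in_tuple s) i)) =
    wsum [seq node_of f | f <- enum {ffun 'I_(size s) -> 'I_M.+1}] x.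
  rewrite /wsum big_map big_enum; apply: eq_bigr => f _ /=.
  by rewrite tsize_node_of exprS expr_sum.
apply: ler_sum_subset => [||t]; last by rewrite exprn_ge0.
  by rewrite map_inj_uniq ?enum_uniq //; exact: node_of_inj.
move=> t /mapP[f _ ->]; rewrite mem_ctrees canonical_node_of //=.
exact: leq_bigmax.
Qed.

(** [phi j t] tells whether [t] may occur [j] times among the children of the root, so that one
    proof serves all trees and the limb-free ones. *)
Lemma wsum_le_prod (s s' : seq rtree) (M : nat) (phi : nat -> rtree -> bool) y :
  0 <= y -> uniq s -> uniq s' ->
  (forall ts, LNode tt ts \in s' -> [/\ canonical (LNode tt ts), {subset ts <= s},
     forall t, (count_mem t ts <= M)%N & forall t, phi (count_mem t ts) t]) ->
  wsum s' y <=
  y * \prod_(t <- s) \sum_(j < M.+1 | phi j t) y ^+ (j * tsize t).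
Proof.
move=> y0 Us Us' H.
pose Q (i : 'I_(size s)) : pred 'I_M.+1 := fun j => phi j (tnth (in_tuple s) i).
rewrite big_tnth (@bigA_distr_big_dep _ _ _ _ _ _ _ Q) big_distrr /=.
have -> : \sum_(f in family Q)
    y * \prod_i y ^+ (f i * tsize (tnth (in_tuple s) i)) =
    wsum [seq node_of f | f <- enum (mem (family Q))] y.
  rewrite /wsum big_map big_enum; apply: eq_bigr => f _ /=.
  by rewrite tsize_node_of exprS expr_sum.
apply: ler_sum_subset => [//|t|t]; last by rewrite exprn_ge0.
case: t => -[] ts /H[ct sub cM ph].
apply/mapP; exists [ffun i => inord (count_mem (tnth (in_tuple s) i) ts)].
  by rewrite mem_enum; apply/familyP => i; rewrite ffunE /Q unfold_in /= inordK ?ltnS.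
by rewrite (node_of_surj Us ct sub cM).
Qed.

Lemma ctrees_children N (ts : seq rtree) : LNode tt ts \in ctrees N.+1 ->
  [/\ canonical (LNode tt ts), {subset ts <= ctrees N} &
      forall t, (count_mem t ts <= N)%N].
Proof.
rewrite mem_ctrees => /andP[ct tN]; split=> // t.
  move=> tts; rewrite mem_ctrees; move: ct => /= /andP[_ /allP-> //].
  by have := leq_trans (tsize_child_lt tt tts) tN.
apply: leq_trans (count_size _ _) _.
by have := leq_trans (size_children_lt tt ts) tN.
Qed.

Lemma wsum_ctrees_le N y : 0 <= y -> wsum (ctrees N.+1) y <=
  y * \prod_(t <- ctrees N) \sum_(j < N.+1) y ^+ (j * tsize t).
Proof.
move=> y0.
apply: (@wsum_le_prod _ _ _ (fun _ _ => true)) => //; rewrite ?ctrees_uniq // => ts.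
by case/ctrees_children => ? ? ?; split.
Qed.

Lemma wsum_lftrees_le N y : 0 <= y -> wsum (lftrees N.+1) y <=
  y * \prod_(t <- lftrees N)
        \sum_(j < N.+1 | (j <= 1)%N || (t != pendant_P2)) y ^+ (j * tsize t).
Proof.
move=> y0; apply: (@wsum_le_prod _ _ _ (fun j t => (j <= 1)%N || (t != pendant_P2))) => //;
  rewrite ?lftrees_uniq // => ts.
rewrite mem_filter => /andP[/= /andP[cP lf] /ctrees_children[ct sub cN]]; split=> // t.
  by move=> tts; rewrite mem_filter sub // (allP lf).
by case: eqP => [->|]; rewrite ?orbT // orbF.
Qed.

End GeneratingFunctions.

(** * Analysis of the generating functions *)

Section Analysis.
Variable R : realType.
Implicit Types x y z a b c : R.

Lemma expr_small x e : 0 <= x < 1 -> 0 < e -> exists n, x ^+ n < e.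
Proof.
move=> /andP[x0 x1] e0.
have /cvgrPdist_lt/(_ e e0)[M _ /(_ M (leqnn M))] :
    ((GRing.exp x : R^nat) @ \oo --> (0 : R))%classic.
  by apply: cvg_expr; rewrite ger0_norm.
by rewrite /= sub0r normrN ger0_norm ?exprn_ge0 //; exists M.
Qed.

Lemma geom_sumE z n : z < 1 -> \sum_(j < n) z ^+ j = (1 - z ^+ n) / (1 - z).
Proof.
move=> z1; have z1' : 1 - z != 0 by rewrite gt_eqF // subr_gt0.
apply: (mulIf z1'); rewrite divfK //.
by rewrite -[1 - z ^+ n]opprB subrX1 -mulNr opprB mulrC.
Qed.

Lemma wsum_ge0 s x : 0 <= x -> 0 <= wsum s x.
Proof. by move=> x0; apply: sumr_ge0 => t _; exact: exprn_ge0. Qed.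

Lemma wsum_mono s x y : 0 <= x -> x <= y -> wsum s x <= wsum s y.
Proof.
by move=> x0 xy; apply: ler_sum => t _; rewrite lerXn2r ?nnegrE // (le_trans x0).
Qed.

Lemma ctrees_subset m n : (m <= n)%N -> {subset ctrees m <= ctrees n}.
Proof. by move=> mn t; rewrite !mem_ctrees => /andP[-> /leq_trans->]. Qed.

Lemma wsum_ctrees_mono m n x : 0 <= x -> (m <= n)%N ->
  wsum (ctrees m) x <= wsum (ctrees n) x.
Proof.
move=> x0 mn; apply: ler_sum_subset (ctrees_uniq m) (ctrees_subset mn) _.
by move=> t; exact: exprn_ge0.
Qed.

Lemma exprt_lt1 (t : rtree) x : 0 <= x < 1 -> x ^+ tsize t < 1.
Proof. by move=> /andP[x0 x1]; rewrite exprn_ilt1 // -lt0n tsize_gt0. Qed.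

Lemma exprt_le (t : rtree) x : 0 <= x < 1 -> x ^+ tsize t <= x.
Proof.
by move=> /andP[x0 x1]; rewrite -[X in _ <= X]expr1 ler_wiXn2l ?tsize_gt0 // ltW.
Qed.

(** The limit M to infinity in [wsum_ctrees_ge]: cutting a geometric series after degree M costs a
    factor at least 1 - x^(M+1) per tree, and Bernoulli's inequality bounds the total loss. *)
Lemma prod_geom_le_bound s x B : 0 < x < 1 -> (forall K, wsum (ctrees K) x <= B) ->
  uniq s -> all canonical s -> x * \prod_(t <- s) (1 - x ^+ tsize t)^-1 <= B.
Proof.
move=> /andP[x0 x1] TB Us cs; set P := \prod_(t <- s) _.
have x01 : 0 <= x < 1 by rewrite ltW.
have P0 : 0 <= P.
  by apply: prodr_ge0 => t _; rewrite invr_ge0 subr_ge0 ltW // exprt_lt1.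
apply/ler_addgt0Pr => e e0.
have D0 : 0 < 1 + P * (size s)%:R by rewrite ltr_wpDr // mulr_ge0.
have [M Me] := expr_small x01 (divr_gt0 e0 D0).
have {}Me : x ^+ M.+1 <= e / (1 + P * (size s)%:R).
  by apply: le_trans (ltW Me); rewrite exprS ger_pMl ?exprn_gt0 // ltW.
have [K HK] := wsum_ctrees_ge M (ltW x0) Us cs.
have bern q n : 0 <= q <= 1 -> 1 - n%:R * q <= (1 - q) ^+ n :> R.
  move=> /andP[q0 q1]; elim: n => [|n IH]; first by rewrite mul0r subr0 expr0.
  rewrite exprS; apply: le_trans (ler_wpM2l _ IH); last by rewrite subr_ge0.
  have : 0 <= n%:R * q * q by rewrite !mulr_ge0.
  rewrite -natr1; lra.
have key : (1 - x ^+ M.+1) ^+ size s * P <= \prod_(t <- s) \sum_(j < M.+1) x ^+ (j * tsize t).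
  rewrite /P -[size s]count_predT -sum1_count -prodrXr -big_split /=.
  rewrite [X in X <= _]big_seq [X in _ <= X]big_seq; apply: ler_prod => t _.
  rewrite expr1; apply/andP; split.
    by rewrite mulr_ge0 // ?invr_ge0 subr_ge0 ?exprn_ile1 // ltW // exprt_lt1.
  under eq_bigr do rewrite mulnC exprM.
  rewrite geom_sumE ?exprt_lt1 // ler_wpM2r ?invr_ge0 ?subr_ge0 ?(ltW (exprt_lt1 _ _)) //.
  rewrite lerD2l lerN2; apply: lerXn2r; rewrite ?nnegrE ?exprn_ge0 ?(ltW x0) //.
  exact: exprt_le.
have H : (1 - (size s)%:R * x ^+ M.+1) * P * x <= B.
  apply: le_trans (TB K); apply: le_trans HK; rewrite mulrC ler_wpM2l ?(ltW x0) //.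
  apply: le_trans key; rewrite ler_wpM2r // bern // exprn_ge0 ?exprn_ile1 ?(ltW x0) ?(ltW x1) //.
have : (size s)%:R * x ^+ M.+1 * P * x <= e.
  have H1 : (size s)%:R * x ^+ M.+1 * P <= e.
    rewrite ler_pdivlMr // in Me; apply: le_trans Me.
    have : 0 <= x ^+ M.+1 by rewrite exprn_ge0 // ltW.
    nra.
  apply: le_trans H1; rewrite ler_piMr ?(ltW x1) // !mulr_ge0 // exprn_ge0 // ltW //.
lra.
Qed.

(* [\prod_(t <- s) (1 - x ^+ tsize t)^-1] with the leading term
   [expR (wsum s x)] factored out. *)
Definition gfac z := expR (- z) / (1 - z).
Definition gprod (s : seq rtree) x := \prod_(t <- s) gfac (x ^+ tsize t).

Lemma gfac_ge1 z : z < 1 -> 1 <= gfac z.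
Proof.
move=> z1; rewrite ler_pdivlMr ?subr_gt0 // mul1r; exact: expR_ge1Dx.
Qed.

Lemma gprod_ge1 s x : 0 <= x < 1 -> 1 <= gprod s x.
Proof.
move=> x01; apply: (big_ind (fun u => 1 <= u)) => // [u v u1 v1|t _].
  by rewrite -[1]mulr1 ler_pM.
by rewrite gfac_ge1 ?exprt_lt1.
Qed.

Lemma prod_geomE s x :
  \prod_(t <- s) (1 - x ^+ tsize t)^-1 = gprod s x * expR (wsum s x).
Proof.
rewrite /gprod /wsum expR_sum -big_split /=; apply: eq_bigr => t _.
by rewrite /gfac mulrAC -expRD addNr expR0 mul1r.
Qed.

(** The logarithmic derivative of [gfac] is z/(1 - z), at most b/(1 - b) on the interval. The proof
    only uses 1 + u <= exp(u) at u = (b - a)/(1 - b). *)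
Lemma gfac_ratio a b : a <= b -> b < 1 ->
  gfac b <= gfac a * expR ((b - a) * b / (1 - b)).
Proof.
move=> ab b1; have b1' : 0 < 1 - b by rewrite subr_gt0.
have a1' : 0 < 1 - a by lra.
have -> : gfac b = expR (- b) * (1 + (b - a) / (1 - b)) / (1 - a).
  rewrite /gfac; field; apply/andP; split; lra.
have -> : gfac a * expR ((b - a) * b / (1 - b)) =
    expR (- b) * expR ((b - a) / (1 - b)) / (1 - a).
  rewrite /gfac mulrAC -!expRD; congr (expR _ / _); field; lra.
by rewrite ler_pM2r ?invr_gt0 // ler_pM2l ?expR_gt0 // expR_ge1Dx.
Qed.

(** Applied with a = x^|t| and b = y^|t|, where 1/(1 - b) <= 4 and (b - a) b is the difference of
    the terms of T at y^2 and xy. The growth of G is thus controlled by T at arguments of order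
    y^2. *)
Lemma gprod_ratio s x y : 0 < x -> x <= y -> y <= 3 / 4 ->
  gprod s y <= gprod s x * expR (4 * (wsum s (y * y) - wsum s (x * y))).
Proof.
move=> x0 xy y34.
have x01 : 0 <= x < 1 by apply/andP; split; lra.
have y01 : 0 <= y < 1 by apply/andP; split; lra.
rewrite /wsum -sumrB mulr_sumr expR_sum -big_split /=; apply: ler_prod => t _.
apply/andP; split; first by apply: le_trans (gfac_ge1 _) => //; exact: exprt_lt1.
have ab : x ^+ tsize t <= y ^+ tsize t by rewrite lerXn2r // nnegrE; lra.
have b0 : 0 <= y ^+ tsize t by rewrite exprn_ge0 //; lra.
have by34 : y ^+ tsize t <= 3 / 4 := le_trans (exprt_le t y01) y34.
apply: le_trans (gfac_ratio ab (exprt_lt1 t y01)) _.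
rewrite ler_wpM2l //; first by apply: le_trans (gfac_ge1 _) => //; exact: exprt_lt1.
rewrite ler_expR !exprMn ler_pdivrMr; last by lra.
move: ab b0 by34; move: (x ^+ _) (y ^+ _) => a b ab b0 b34.
have : 0 <= (b - a) * b by rewrite mulr_ge0 // subr_ge0.
nra.
Qed.

(** Chord slopes of the convex function z^n increase; denominators are cleared so that induction on
    [n] applies. *)
Lemma exprn_convex a b c n : 0 <= a -> a <= b -> b <= c ->
  (b ^+ n - a ^+ n) * (c - b) <= (b - a) * (c ^+ n - b ^+ n).
Proof.
move=> a0 ab bc; elim: n => [|n IH]; first by rewrite !expr0 !subrr mul0r mulr0.
have acn : a ^+ n <= c ^+ n by rewrite lerXn2r ?nnegrE //; lra.
have -> : (b ^+ n.+1 - a ^+ n.+1) * (c - b) =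
  b * ((b ^+ n - a ^+ n) * (c - b)) + a ^+ n * ((b - a) * (c - b)) by rewrite !exprS; ring.
have -> : (b - a) * (c ^+ n.+1 - b ^+ n.+1) =
  b * ((b - a) * (c ^+ n - b ^+ n)) + c ^+ n * ((b - a) * (c - b)) by rewrite !exprS; ring.
apply: lerD; first by rewrite ler_wpM2l //; lra.
by rewrite ler_wpM2r // mulr_ge0 //; lra.
Qed.

(** By convexity, the slope on [a, b] is at most that on [b, c]; this stands in for a bound on the
    derivative of T. *)
Lemma wsum_increment s a b c : 0 <= a -> a <= b -> b < c ->
  wsum s b - wsum s a <= (b - a) / (c - b) * wsum s c.
Proof.
move=> a0 ab bc; rewrite /wsum -sumrB mulr_sumr; apply: ler_sum => t _.
have cb : 0 < c - b by lra.
rewrite mulrAC ler_pdivlMr //; apply: le_trans (exprn_convex _ a0 ab (ltW bc)) _.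
by rewrite ler_wpM2l ?subr_ge0 // gerBl exprn_ge0 // (le_trans a0).
Qed.

(** Passing to the supremum S of the partial sums at x gives x G(x) exp(S) <= S, and e S <= exp(S)
    finishes. *)
Lemma gprod_critical N x B : 0 < x < 1 -> (forall K, wsum (ctrees K) x <= B) ->
  x * gprod (ctrees N) x * expR 1 <= 1.
Proof.
move=> x01 TB; have /andP[x0 x1] := x01; have x01' : 0 <= x < 1 by rewrite ltW.
have hs : has_sup (range (fun K => wsum (ctrees K) x)).
  split; first by exists (wsum (ctrees 0) x); exists 0%N.
  by exists B => _ [K _ <-].
pose S := sup (range (fun K => wsum (ctrees K) x)).
have TS K : wsum (ctrees K) x <= S.
  by apply: sup_upper_bound => //; exists K.
have G1 := gprod_ge1 (ctrees N) x01'.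
suff H : x * gprod (ctrees N) x * expR S <= S.
  have e1 : S * expR 1 <= expR S.
    have -> : expR S = expR (S - 1) * expR 1 by rewrite -expRD subrK.
    rewrite ler_pM2r ?expR_gt0 //; have := expR_ge1Dx (S - 1); lra.
  rewrite -(ler_pM2r (expR_gt0 S)) mul1r.
  apply: le_trans e1; rewrite mulrAC ler_pM2r ?expR_gt0 //.
apply/ler_addgt0Pr => e e0.
have S0 : 0 <= S by apply: le_trans (TS 0%N); rewrite wsum_ge0 // ltW.
(* A partial sum within [d] of S changes exp(S) by a factor at most exp(d), so [d] is chosen to make
   this cost at most [e]. *)
have [d d0 dS] : exists2 d, 0 < d & S * expR d <= S + e.
  exists (ln (1 + e / (1 + S))); first by rewrite ln_gt0 // ltrDl divr_gt0 //; lra.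
  rewrite lnK ?posrE ?addr_gt0 ?divr_gt0 //; try lra.
  rewrite mulrDr mulr1 lerD2l mulrCA ger_pMr // ler_pdivrMr; lra.
have [_ [K _ <-] Kd] := sup_adherent d0 hs.
rewrite -/S in Kd; pose L := maxn K N.
have LK : wsum (ctrees K) x <= wsum (ctrees L) x.
  by rewrite wsum_ctrees_mono ?leq_maxl // ltW.
have GL : gprod (ctrees N) x <= gprod (ctrees L) x.
  have [t Ht] : exists s, perm_eq (ctrees L) (ctrees N ++ s).
    exists [seq t <- ctrees L | t \notin ctrees N].
    apply: uniq_perm; first exact: ctrees_uniq.
      rewrite cat_uniq ctrees_uniq filter_uniq ?ctrees_uniq // andbT /=.
      by apply/hasPn => t; rewrite mem_filter => /andP[].
    move=> t; rewrite mem_cat mem_filter.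
    case: (boolP (t \in ctrees N)) => //= tN.
    by rewrite (ctrees_subset (leq_maxr K N)).
  rewrite {2}/gprod (perm_big _ Ht) big_cat /= ler_peMr ?gprod_ge1 //.
  exact: le_trans ler01 G1.
have cL : all canonical (ctrees L).
  by apply/allP => t; rewrite mem_ctrees => /andP[].
have := prod_geom_le_bound x01 TS (ctrees_uniq L) cL.
rewrite prod_geomE => H.
apply: le_trans dS.
have -> : expR S = expR (S - d) * expR d by rewrite -expRD subrK.
rewrite mulrA ler_pM2r ?expR_gt0 //; apply: le_trans H.
rewrite -mulrA ler_pM2l //; apply: ler_pM => //; rewrite ?expR_ge0 //.
  exact: le_trans ler01 G1.
by rewrite ler_expR; lra.
Qed.

End Analysis.

(** * The radius of convergence rho, and a bound for the limb-free series beyond it *)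

Section Growth.
Variable R : realType.
Implicit Types x y z a b c : R.

Definition wbounded x := exists B : R, forall K, wsum (ctrees K) x <= B.

Lemma wbounded_le x y : 0 <= x -> x <= y -> wbounded y -> wbounded x.
Proof.
by move=> x0 xy [B HB]; exists B => K; apply: le_trans (HB K); exact: wsum_mono.
Qed.

Lemma geom_sum_le z n : 0 <= z -> z < 1 -> \sum_(j < n) z ^+ j <= (1 - z)^-1.
Proof.
move=> z0 z1; rewrite geom_sumE // ler_piMl ?invr_ge0 ?subr_ge0 ?(ltW z1) //.
by rewrite gerBl exprn_ge0.
Qed.

Lemma expR1_le4 : expR 1 <= 4 :> R.
Proof.
have h : 0 < expR (2^-1 : R) <= 2.
  rewrite expR_gt0 /=; have := expR_ge1Dx (- 2^-1 : R); rewrite expRN => h.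
  have : (expR 2^-1 : R)^-1 >= 2^-1 by lra.
  by rewrite lef_pV2 ?posrE ?expR_gt0.
have -> : (1 : R) = 2^-1 + 2^-1 by field.
rewrite expRD; move: h; move: (expR _) => e /andP[]; nra.
Qed.

Lemma expR1_ge2 : 2 <= expR 1 :> R.
Proof. by have := expR_ge1Dx (1 : R). Qed.

(** The bound 1/2 reproduces itself: 1/(1 - z) <= exp(2z) for z <= 1/8, so the next partial sum is
    at most exp(2 * 1/2)/8 <= 4/8. *)
Lemma wbounded_eighth : wbounded (8^-1 : R).
Proof.
exists 2^-1 => K; elim: K => [|K IH]; first by rewrite /wsum /ctrees /= big_nil.
have x0 : 0 <= (8^-1 : R) by rewrite invr_ge0.
have x01 : 0 <= (8^-1 : R) < 1 by rewrite x0 invf_lt1 ?ltr1n.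
apply: le_trans (wsum_ctrees_le _ x0) _.
have e4 := expR1_le4.
suff : \prod_(t <- ctrees K) \sum_(j < K.+1) (8^-1 : R) ^+ (j * tsize t) <= expR 1 by lra.
apply: (@le_trans _ _ (expR (2 * wsum (ctrees K) 8^-1))); last by rewrite ler_expR; lra.
rewrite /wsum mulr_sumr expR_sum; apply: ler_prod => t _.
apply/andP; split; first by apply: sumr_ge0 => j _; rewrite exprn_ge0.
under eq_bigr do rewrite mulnC exprM.
have z0 : 0 <= (8^-1 : R) ^+ tsize t by rewrite exprn_ge0.
have z8 := exprt_le t x01; have z1 := exprt_lt1 t x01.
apply: le_trans (geom_sum_le _ z0 z1) _; move: z0 z8 z1; move: (_ ^+ tsize t) => z z0 z8 z1.
have z1' : 0 < 1 - z by lra.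
rewrite -[_^-1]mul1r ler_pdivrMr //.
have : 1 + 2 * z <= expR (2 * z) := expR_ge1Dx _.
nra.
Qed.

Definition rho_set : set R := [set x | 0 < x < 1 /\ wbounded x]%classic.
Definition rho : R := sup rho_set.

(** With an empty product the critical inequality reads x e <= 1, and e >= 2. *)
Lemma wbounded_le_half x : 0 < x < 1 -> wbounded x -> x <= 2^-1.
Proof.
move=> x01 [B HB]; have := gprod_critical 0 x01 HB.
rewrite /gprod /ctrees /= big_nil mulr1; have := expR1_ge2; move/andP: x01 => [x0 _].
nra.
Qed.

Lemma rho_has_sup : has_sup rho_set.
Proof.
split; first by exists 8^-1; split; [lra | exact: wbounded_eighth].
by exists 2^-1 => x [x01 bx]; exact: wbounded_le_half.
Qed.

Lemma rho_bounds : 8^-1 <= rho <= 2^-1.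
Proof.
apply/andP; split.
  apply: sup_upper_bound rho_has_sup _ _.
  by split; [lra | exact: wbounded_eighth].
apply: ge_sup; first by case: rho_has_sup.
by move=> x [x01 bx]; exact: wbounded_le_half.
Qed.

Lemma wbounded_lt_rho x : 0 < x -> x < rho -> wbounded x.
Proof.
move=> x0 xr; have [|y [/andP[y0 y1] by_] xy] := sup_adherent (_ : 0 < rho - x) rho_has_sup.
  by rewrite subr_gt0.
by apply: wbounded_le by_; rewrite ltW //; rewrite -/rho opprB addrC subrK in xy.
Qed.

Lemma not_wbounded_gt_rho x : rho < x -> x < 1 -> ~ wbounded x.
Proof.
move=> rx x1 bx; have /andP[r8 _] := rho_bounds.
have : x <= rho.
  by apply: sup_upper_bound rho_has_sup _ _; split => //; lra.
lra.
Qed.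

(** In [gprod_beyond_rho], 40 d bounds ln(y/x) and 240 d B bounds the growth of ln G; together they
    must not exceed y^4, where y >= 1/8. *)
Lemma small_step (B : R) : 0 <= B ->
  exists d, [/\ 0 < d, d <= 1 / 64 & 40 * d + 240 * (d * B) <= (1 / 8) ^+ 4].
Proof.
move=> B0; set f : R := (1 / 8) ^+ 4.
have f8 : f <= 1 / 8 by rewrite /f -[X in _ <= X]expr1 ler_wiXn2l //; lra.
have f0 : 0 < f by rewrite exprn_gt0 //; lra.
have B1 : 0 < 1 + B by lra.
pose e := f * (1 / 8 * (1 / 8 * (1 / 8))).
exists (e / (1 + B)).
have ed : e / (1 + B) + e / (1 + B) * B = e by field; lra.
have d0 : 0 < e / (1 + B) by rewrite divr_gt0 // /e; lra.
have dB0 : 0 <= e / (1 + B) * B by rewrite mulr_ge0 // ltW.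
move: ed d0 dB0; move: (e / (1 + B)) => d; move: (d * B) => dB; rewrite /e => ed d0 dB0.
split; lra.
Qed.

(* At [y] slightly above [rho] the factor [1 - y ^+ 4] outweighs the growth of
   [gprod]. *)
Lemma gprod_beyond_rho : exists y, [/\ rho < y, y <= 17 / 32 &
  forall N, y * (1 - y ^+ 4) * gprod (ctrees N) y * expR 1 <= 1].
Proof.
have /andP[r8 r2] := rho_bounds.
(* A reference point below rho that still leaves room above y^2, which is about rho^2 <= rho/2. *)
have [B HB] : wbounded (3 / 4 * rho) by apply: wbounded_lt_rho; lra.
have B0 : 0 <= B by apply: le_trans (HB 0%N); apply: wsum_ge0; lra.
have [d [d0 d64 dB]] := small_step B0.
pose x := rho - d; pose y := rho + d.
have x01 : 0 < x < 1 by rewrite /x; lra.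
have bx : wbounded x by apply: wbounded_lt_rho; rewrite /x; lra.
have y2 : y * y <= (3 / 4 * rho) - 1 / 50.
  rewrite /y; nra.
exists y; split; [by rewrite /y; lra | by rewrite /y; lra | move=> N].
have [C HC] := bx.
have crit := gprod_critical N x01 HC.
have x0 : 0 < x by case/andP: x01.
have xy : x <= y by rewrite /x /y; lra.
have ratio := @gprod_ratio R (ctrees N) x y x0 xy ltac:(by rewrite /y; lra).
have incr := @wsum_increment R (ctrees N) (x * y) (y * y) (3 / 4 * rho).
have {}incr : wsum (ctrees N) (y * y) - wsum (ctrees N) (x * y) <= 60 * (d * B).
  apply: le_trans (incr _ _ _) _; [by apply: mulr_ge0; lra | by apply: ler_wpM2r; lra | lra |].
  have W0 : 0 <= wsum (ctrees N) (3 / 4 * rho) by apply: wsum_ge0; lra.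
  have c0 : 0 < 3 / 4 * rho - y * y by lra.
  (* The numerator is 2 d y with y <= 17/32 and the denominator at least 1/50, so the quotient is
     below 54 d. *)
  have coef : (y * y - x * y) / (3 / 4 * rho - y * y) <= 60 * d.
    rewrite ler_pdivrMr //.
    have -> : y * y - x * y = 2 * d * y by rewrite /x /y; ring.
    have : y <= 17 / 32 by rewrite /y; lra.
    nra.
  have cf0 : 0 <= (y * y - x * y) / (3 / 4 * rho - y * y).
    by rewrite divr_ge0 ?(ltW c0) // -mulrBl mulr_ge0 //; lra.
  by rewrite mulrA; exact: (ler_pM cf0 W0 coef (HB N)).
(* Here y - x = 2 d and x >= 7/64, so y/x <= 1 + 40 d. *)
have yx : y <= x * expR (40 * d).
  have : 1 + 40 * d <= expR (40 * d) := expR_ge1Dx _.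
  rewrite /x /y in x0 *; nra.
have y4 : 1 - y ^+ 4 <= expR (- y ^+ 4) := expR_ge1Dx _.
have y4' : (1 / 8) ^+ 4 <= y ^+ 4 by apply: lerXn2r; rewrite ?nnegrE /y; lra.
have y41 : 0 <= 1 - y ^+ 4 by rewrite subr_ge0; apply: exprn_ile1; rewrite /y; lra.
have g0 : 0 <= gprod (ctrees N) x.
  by apply: le_trans ler01 (gprod_ge1 _ _); lra.
have e0 := expR_gt0 (1 : R).
have step : y * (1 - y ^+ 4) * gprod (ctrees N) y <=
    (x * gprod (ctrees N) x) * (expR (40 * d) * expR (- y ^+ 4) *
     expR (4 * (wsum (ctrees N) (y * y) - wsum (ctrees N) (x * y)))).
  have -> : (x * gprod (ctrees N) x) * (expR (40 * d) * expR (- y ^+ 4) *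
     expR (4 * (wsum (ctrees N) (y * y) - wsum (ctrees N) (x * y)))) =
    (x * expR (40 * d)) * expR (- y ^+ 4) * (gprod (ctrees N) x *
      expR (4 * (wsum (ctrees N) (y * y) - wsum (ctrees N) (x * y)))) by ring.
  have y0 : 0 <= y by rewrite /y; lra.
  apply: ler_pM => //; first by rewrite mulr_ge0.
    by apply: le_trans ler01 (gprod_ge1 _ _); rewrite /y; lra.
  by apply: ler_pM.
rewrite -!expRD in step.
have : expR (40 * d - y ^+ 4 +
   4 * (wsum (ctrees N) (y * y) - wsum (ctrees N) (x * y))) <= 1.
  apply: (@le_trans _ _ (expR 0)); last by rewrite expR0.
  rewrite ler_expR; lra.
move: step crit g0; move: (expR (_ + _)) (gprod (ctrees N) x) (y * _ * _) => E g Y step crit g0 E1.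
have : Y <= x * g.
  apply: le_trans step _; rewrite ler_piMr // mulr_ge0 // ltW //.
move=> Yg; apply: le_trans crit; by rewrite ler_wpM2r // ltW.
Qed.

Lemma gprod_lftrees_le N x : 0 <= x < 1 -> gprod (lftrees N) x <= gprod (ctrees N) x.
Proof.
move=> x01; rewrite /gprod big_filter big_mkcond /=; apply: ler_prod => t _.
have g1 : 1 <= gfac (x ^+ tsize t) by rewrite gfac_ge1 ?exprt_lt1.
by case: limb_free; rewrite ?lexx ?(le_trans ler01 g1) ?ler01.
Qed.

Lemma mem_pendant_P2 N : (2 <= N)%N -> pendant_P2 \in lftrees N.
Proof. by move=> N2; rewrite mem_lftrees /= !tsizeE big_seq1 tsizeE big_nil. Qed.

Lemma wsum_lftrees2 y : 0 <= y -> wsum (lftrees 2) y <= y + y ^+ 2.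
Proof.
move=> y0; have -> : y + y ^+ 2 = wsum [:: LNode tt [::]; pendant_P2] y.
  by rewrite /wsum !big_cons big_nil addr0 /tsize.
apply: ler_sum_subset (lftrees_uniq 2) _ _ => t; last exact: exprn_ge0.
rewrite mem_lftrees => /and3P[_ _]; case: t => -[] [|[[] [|s ss]] [|t ts]] //.
- by rewrite !tsizeE !big_cons !tsizeE; have := tsize_gt0 t; lia.
- by rewrite !tsizeE !big_cons !tsizeE big_cons; have := tsize_gt0 s; lia.
- by rewrite !tsizeE !big_cons !tsizeE big_cons; have := tsize_gt0 s; lia.
Qed.

(** If the partial sum W_N is at most 1, then W_(N+1) <= y (1 - y^4) G(y) exp(W_N) <= y (1 - y^4)
    G(y) e <= 1. *)
Lemma wsum_lftrees_le1 : exists y, [/\ rho < y, y <= 17 / 32 &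
  forall N, wsum (lftrees N) y <= 1].
Proof.
have [y [ry y17 Hy]] := gprod_beyond_rho; have /andP[r8 _] := rho_bounds.
exists y; split=> //.
have y01 : 0 <= y < 1 by lra.
have [y0 y1] := andP y01.
(* Starting at size 2 puts [pendant_P2] among the factors, so the gain 1 - y^4 is available at every
   step. *)
suff H N : wsum (lftrees N.+2) y <= 1.
  move=> N; apply: le_trans (H N); apply: ler_sum_subset (lftrees_uniq _) _ _ => t.
    rewrite !mem_lftrees => /and3P[-> -> /=] tN.
    by apply: leq_trans tN _; rewrite -addn2 leq_addr.
  exact: exprn_ge0.
elim: N => [|N IH]; first by apply: le_trans (wsum_lftrees2 y0) _; nra.
apply: le_trans (wsum_lftrees_le _ y0) _; apply: le_trans (Hy N.+2).
have P2in := mem_pendant_P2 (isT : (2 <= N.+2)%N).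
have geo (t : rtree) : \sum_(j < N.+3) y ^+ (j * tsize t) <= (1 - y ^+ tsize t)^-1.
  under eq_bigr do rewrite mulnC exprM.
  exact: geom_sum_le _ (exprn_ge0 _ y0) (exprt_lt1 t y01).
have -> : y * (1 - y ^+ 4) * gprod (ctrees N.+2) y * expR 1 =
  y * ((1 - y ^+ 4) * (gprod (ctrees N.+2) y * expR 1)) by ring.
rewrite ler_wpM2l //.
apply: (@le_trans _ _ ((1 - y ^+ 4) * \prod_(t <- lftrees N.+2) (1 - y ^+ tsize t)^-1)); last first.
  rewrite prod_geomE ler_wpM2l ?subr_ge0 ?exprn_ile1 ?(ltW y1) //.
  apply: ler_pM; rewrite ?expR_ge0 ?gprod_lftrees_le ?ler_expR //.
  exact: le_trans ler01 (gprod_ge1 _ y01).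
(* The factor of [pendant_P2] is split off on both sides, where 1 + y^2 = (1 - y^4)/(1 - y^2); the
   other factors are compared one by one. *)
rewrite (big_rem _ P2in) [X in _ <= _ * X](big_rem _ P2in) /= mulrA.
have nn (t : rtree) (P : pred 'I_N.+3) : 0 <= \sum_(j < N.+3 | P j) y ^+ (j * tsize t).
  by apply: sumr_ge0 => j _; rewrite exprn_ge0.
apply: ler_pM => //.
- by apply: prodr_ge0 => t _; exact: nn.
- have -> : \sum_(j < N.+3 | (j <= 1)%N || false) y ^+ (j * tsize pendant_P2) = 1 + y ^+ 2.
    rewrite big_mkcond !big_ord_recl /= mul0n expr0 mul1n big1 ?addr0 //.
  have -> : tsize pendant_P2 = 2%N by [].
  rewrite ler_pdivlMr; last by rewrite subr_gt0 exprn_ilt1.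
  have -> : (1 + y ^+ 2) * (1 - y ^+ 2) = 1 - y ^+ 4 by ring.
  exact: lexx.
- apply: ler_prod => t _; rewrite nn /=; apply: le_trans (geo t).
  rewrite [X in X <= _]big_mkcond; apply: ler_sum => j _; case: ifP => // _.
  exact: exprn_ge0.
Qed.

End Growth.

(** * Trees with exactly n nodes and the growth of their number *)

Local Open Scope nat_scope.

Definition trees_of (n : nat) : seq rtree := [seq t <- ctrees n | tsize t == n].
Definition lftrees_of (n : nat) : seq rtree := [seq t <- lftrees n | tsize t == n].

Lemma trees_of_uniq n : uniq (trees_of n).
Proof. exact/filter_uniq/ctrees_uniq. Qed.

Lemma mem_trees_of n t : (t \in trees_of n) = canonical t && (tsize t == n).
Proof.
rewrite mem_filter mem_ctrees andbC; case: canonical => //=.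
by case: eqP => [->|]; rewrite ?leqnn ?andbF.
Qed.

Lemma mem_lftrees_of n t :
  (t \in lftrees_of n) = [&& limb_free t, canonical t & tsize t == n].
Proof.
rewrite mem_filter mem_lftrees; case: eqP => [<-|_]; last by rewrite !andbF.
by rewrite leqnn.
Qed.

Lemma size_trees_of_mul m n :
  size (trees_of m) * size (trees_of n) <= 2 * size (trees_of (m + n).+1).
Proof.
(* The ordered pairs from which a tree with a binary root arises. The dummy value for other roots
   keeps every list at length two, whence the factor 2. *)
pose pre (t : rtree) : seq (rtree * rtree) :=
  if t is LNode _ [:: a; b] then [:: (a, b); (b, a)] else [:: (t, t); (t, t)].
rewrite -(size_allpairs pair) mulnC.
have -> : size (trees_of (m + n).+1) * 2 = size (flatten (map pre (trees_of (m + n).+1))).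
  rewrite size_flatten /seq.shape -map_comp sumnE big_map.
  rewrite (eq_bigr (fun=> 2)); last by move=> [a [|b [|c [|d ts]]]].
  by rewrite big_const_seq count_predT iter_addn addn0 mulnC.
apply: uniq_leq_size => [|[a b] /allpairsP[[a' b']]].
  by rewrite allpairs_uniq ?trees_of_uniq // => -[? ?] [? ?] _ _.
rewrite !mem_trees_of => -[/andP[ca /eqP sa] /andP[cb /eqP sb] [-> ->]] {a b}.
move: ca sa cb sb => /=.
move: a' b' => a b ca sa cb sb.
apply/flattenP; exists (pre (LNode tt (sort tle [:: a; b]))); last first.
  have : perm_eq (sort tle [:: a; b]) [:: a; b] by rewrite perm_sort.
  move: (sort tle _) => s; move/[dup]/perm_size; case: s => [|c [|d []]] // _ pe.
  rewrite /= !inE !xpair_eqE.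
  have sing e e' : perm_eq [:: e] [:: e'] -> e = e'.
    by move=> /perm_mem/(_ e); rewrite !inE eqxx => /esym/eqP.
  have : c \in [:: a; b] by rewrite -(perm_mem pe) mem_head.
  rewrite !inE => /orP[] /eqP E; move: pe; rewrite E.
    by rewrite perm_cons => /sing->; rewrite !eqxx.
  have ab : perm_eq [:: a; b] [:: b; a] by rewrite (perm_catC [:: a] [:: b]).
  by rewrite (permPr ab) perm_cons => /sing->; rewrite !eqxx orbT.
apply: map_f; rewrite mem_trees_of /= sort_sorted; last exact: tle_total.
rewrite all_sort /= ca cb tsizeE (perm_big _ (permEl (perm_sort _ _))) /=.
by rewrite !big_cons big_nil sa sb addn0 /= eqxx.
Qed.

Lemma size_trees_of_mono m n : m <= n -> size (trees_of m) <= size (trees_of n).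
Proof.
move=> /subnK<-; elim: (n - m) => [|k IH] //; apply: leq_trans IH _; rewrite addSn.
rewrite -(size_map (fun t => LNode tt [:: t])); apply: uniq_leq_size.
  by rewrite map_inj_uniq ?trees_of_uniq // => t t' [].
move=> _ /mapP[t tin ->]; move: tin; rewrite !mem_trees_of /= andbT.
by move=> /andP[-> /eqP st]; rewrite tsizeE big_seq1 st eqxx.
Qed.

Local Open Scope ring_scope.

Section Ratio.
Variable R : realType.
Implicit Types x y z : R.

Lemma wsum_ctreesS N x : wsum (ctrees N.+1) x =
  wsum (ctrees N) x + (size (trees_of N.+1))%:R * x ^+ N.+1.
Proof.
rewrite /wsum (perm_big (ctrees N ++ trees_of N.+1)) /=.
  rewrite big_cat /=; congr (_ + _); rewrite (eq_big_seq (fun=> x ^+ N.+1)).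
    by rewrite big_const_seq count_predT iter_addr addr0 mulr_natl.
  by move=> t; rewrite mem_trees_of => /andP[_ /eqP->].
apply: uniq_perm; first exact: ctrees_uniq.
  rewrite cat_uniq ctrees_uniq trees_of_uniq andbT /=.
  apply/hasPn => t; rewrite mem_trees_of mem_ctrees => /andP[-> /eqP->] /=.
  by rewrite ltnn.
move=> t; rewrite mem_cat mem_trees_of !mem_ctrees; case: canonical => //=.
by rewrite leq_eqVlt ltnS orbC.
Qed.

(** Were r_m z^(m+1) <= 2 for all m, T would be dominated at the midpoint x of rho and z by a
    geometric series of ratio x/z, although x > rho. The threshold 2 is the one that
    [size_trees_of_mul] reproduces. *)
Lemma size_trees_of_lower z : rho R < z -> z < 1 -> exists m,
  2 < (size (trees_of m))%:R * z ^+ m.+1.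
Proof.
move=> rz z1; have /andP[r8 _] := rho_bounds R.
pose x := (rho R + z) / 2.
have x0 : 0 < x by rewrite /x; lra.
have xz : x < z by rewrite /x; lra.
apply: contrapT => /forallNP H; apply: (@not_wbounded_gt_rho R x); try by rewrite /x; lra.
have z0 : 0 < z by lra.
have q0 : 0 <= x / z by rewrite divr_ge0 // ltW.
have q1 : x / z < 1 by rewrite ltr_pdivrMr // mul1r.
exists (2 / z * (1 - x / z)^-1) => K.
apply: (@le_trans _ _ (2 / z * \sum_(j < K.+1) (x / z) ^+ j)); last first.
  by rewrite ler_wpM2l ?geom_sum_le // divr_ge0 // ltW.
elim: K => [|K IH].
  rewrite /wsum /ctrees /= big_nil mulr_ge0 ?sumr_ge0 // ?divr_ge0 ?(ltW z0) // => j _.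
  exact: exprn_ge0.
rewrite wsum_ctreesS big_ord_recr mulrDr /=; apply: lerD => //.
have /negP := H K.+1%N; rewrite -leNgt => HK.
have -> : 2 / z * (x / z) ^+ K.+1 = 2 / z ^+ K.+2 * x ^+ K.+1.
  by rewrite expr_div_n [z ^+ K.+2]exprS invfM mulrA mulrAC mulrA.
apply: ler_wpM2r; first by rewrite exprn_ge0 // ltW.
by rewrite ler_pdivlMr // exprn_gt0.
Qed.

(** For b_k = r_(k-1) z^k, [size_trees_of_mul] reads b_j b_k <= 2 b_(j+k), so one value b_k >= 2
    forces b_(qk) >= 2 for all q >= 1. Monotonicity of r reaches the other indices at the cost of a
    factor z^k. *)
Lemma size_trees_of_ge z : rho R < z -> z < 1 -> exists2 c, 0 < c &
  exists n0, forall n, (n0 <= n)%N -> c <= (size (trees_of n))%:R * z ^+ n.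
Proof.
move=> rz z1; have /andP[r8 _] := rho_bounds R.
have z0 : 0 < z by lra.
have [m Hm] := size_trees_of_lower rz z1.
have Hq q : 2 <= (size (trees_of (q.+1 * m.+1).-1))%:R * z ^+ (q.+1 * m.+1).
  elim: q => [|q IH]; first by rewrite mul1n ltW.
  have -> : ((q.+2 * m.+1).-1 = ((q.+1 * m.+1).-1 + m).+1)%N by lia.
  have -> : (q.+2 * m.+1 = q.+1 * m.+1 + m.+1)%N by lia.
  have := size_trees_of_mul (q.+1 * m.+1).-1 m; rewrite -(ler_nat R) !natrM exprD.
  set u := z ^+ m.+1; set v := z ^+ (q.+1 * m.+1) => H.
  have uv : 0 <= v * u by rewrite mulr_ge0 // exprn_ge0 // ltW.
  have two : 0 <= 2 :> R by [].
  have := ler_pM two two IH (ltW Hm); have := ler_wpM2r uv H.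
  rewrite -/u -/v; lra.
exists (2 * z ^+ m.+1); first by rewrite mulr_gt0 ?exprn_gt0.
exists m => n mn.
(* (q + 1)(m + 1) is the largest multiple of m + 1 not exceeding n + 1. *)
pose q := (n.+1 %/ m.+1).-1%N.
have qE : (q.+1 * m.+1 <= n.+1)%N.
  by rewrite /q prednK ?divn_gt0 // leq_divM.
have qE' : (n.+1 <= q.+1 * m.+1 + m.+1)%N.
  by rewrite /q prednK ?divn_gt0 // -mulSnr ltnW // -ltn_divLR.
apply: (@le_trans _ _ ((size (trees_of n))%:R * z ^+ n.+1)); last first.
  by rewrite ler_wpM2l // exprS ler_piMl ?exprn_ge0 // ltW.
apply: (@le_trans _ _ ((size (trees_of (q.+1 * m.+1).-1))%:R * z ^+ n.+1)); last first.
  rewrite ler_wpM2r ?exprn_ge0 ?(ltW z0) // ler_nat; apply: size_trees_of_mono.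
  by move: qE; case: (q.+1 * m.+1)%N.
rewrite -(subnKC qE) exprD mulrA; apply: ler_pM; rewrite ?exprn_ge0 ?(ltW z0) //.
by rewrite ler_wiXn2l ?(ltW z0) ?(ltW z1) // leq_subLR.
Qed.

(** For rho < z < y, a_n y^n <= 1 and r_n z^n >= c, so the ratio a_n / r_n decays like (z/y)^n. *)
Lemma lftrees_of_ratio : exists c q : R, [/\ 0 < c, 0 < q < 1 &
  exists n0, forall n, (n0 <= n)%N ->
    c * (size (lftrees_of n))%:R <= q ^+ n * (size (trees_of n))%:R].
Proof.
have [y [ry y17 Hy]] := wsum_lftrees_le1 R; have /andP[r8 _] := rho_bounds R.
pose z := (rho R + y) / 2.
have z0 : 0 < z by rewrite /z; lra.
have zy : z < y by rewrite /z; lra.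
have y0 : 0 < y by lra.
have [c c0 [n0 Hc]] := @size_trees_of_ge z ltac:(by rewrite /z; lra) ltac:(by rewrite /z; lra).
exists c, (z / y); split=> //; first by rewrite divr_gt0 //= ltr_pdivrMr // mul1r.
exists n0 => n /Hc cn.
have an : (size (lftrees_of n))%:R * y ^+ n <= 1.
  apply: le_trans (Hy n); apply: (@le_trans _ _ (wsum (lftrees_of n) y)).
    rewrite /wsum (eq_big_seq (fun=> y ^+ n)).
      by rewrite big_const_seq count_predT iter_addr addr0 mulr_natl.
    by move=> t; rewrite mem_filter => /andP[/eqP->].
  apply: ler_sum_subset => [|t|t]; first exact/filter_uniq/lftrees_uniq.
    by rewrite mem_filter => /andP[].
  by rewrite exprn_ge0 // ltW.
rewrite expr_div_n mulrAC ler_pdivlMr ?exprn_gt0 // -mulrA.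
apply: le_trans (_ : c * 1 <= _); first by rewrite ler_pM2l.
by rewrite mulr1 mulrC.
Qed.

End Ratio.

(** * Isomorphism classes of trees *)

Section IsoClasses.
Variable n : nat.
Implicit Types (g h : graph n) (P Q : graph n -> Prop).

Lemma graph_isoP g h :
  reflect (exists s : 'S_n, forall x y, h (s x) (s y) = g x y) (graph_iso g h).
Proof.
apply: (iffP existsP) => -[s H]; exists s.
  by move=> x y; move/forallP: H => /(_ x)/forallP/(_ y)/eqP.
by apply/forallP => x; apply/forallP => y; rewrite H.
Qed.

Lemma graph_iso_refl g : graph_iso g g.
Proof. by apply/graph_isoP; exists 1%g => x y; rewrite !perm1. Qed.

Lemma graph_iso_sym g h : graph_iso g h -> graph_iso h g.
Proof.
move=> /graph_isoP[s H]; apply/graph_isoP; exists (s^-1)%g => x y.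
by rewrite -H !permKV.
Qed.

Lemma graph_iso_trans g h k : graph_iso g h -> graph_iso h k -> graph_iso g k.
Proof.
move=> /graph_isoP[s H] /graph_isoP[s' H']; apply/graph_isoP.
by exists (s * s')%g => x y; rewrite !permM H' H.
Qed.

Definition iso_class g : {set graph n} := [set h | graph_iso g h].

Lemma iso_class_eq g h : graph_iso g h -> iso_class g = iso_class h.
Proof.
move=> gh; apply/setP => k; rewrite !inE; apply/idP/idP; last exact: graph_iso_trans.
exact/graph_iso_trans/graph_iso_sym.
Qed.

(** [num_iso_classes] cuts each class down to the graphs satisfying [P]. Whole classes are used here
    so that counts for different properties can be compared; cutting down is injective on classes
    meeting [P]. *)
Definition iso_classes P : {set {set graph n}} :=
  [set iso_class g | g in (fun g => `[< P g >])].

Lemma iso_classesP P K :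
  reflect (exists2 g, P g & K = iso_class g) (K \in iso_classes P).
Proof.
apply: (iffP imsetP) => -[g Pg ->]; exists g => //.
  by move: Pg; rewrite unfold_in => /asboolP.
by rewrite unfold_in; apply/asboolP.
Qed.

Lemma num_iso_classesE P : num_iso_classes P = #|iso_classes P|.
Proof.
rewrite /num_iso_classes; set D := finset _.
have DP g : g \in D = `[< P g >] by rewrite inE.
have -> : equivalence_partition (@graph_iso n) D = [set K :&: D | K in iso_classes P].
  apply/setP => A; apply/imsetP/imsetP => -[].
    move=> g; rewrite DP => /asboolP Pg ->; exists (iso_class g).
      by apply/iso_classesP; exists g.
    by apply/setP => h; rewrite !inE andbC.
  move=> _ /iso_classesP[g Pg ->] ->; exists g; first by rewrite DP; apply/asboolP.
  by apply/setP => h; rewrite !inE andbC.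
apply: card_in_imset => _ _ /iso_classesP[g Pg ->] /iso_classesP[h Ph ->] /setP/(_ h).
rewrite finset.in_setI [RHS]finset.in_setI DP (asboolT Ph) !andbT !inE graph_iso_refl.
exact: iso_class_eq.
Qed.

Lemma num_iso_classes_mono P Q : (forall g, P g -> Q g) ->
  (num_iso_classes P <= num_iso_classes Q)%N.
Proof.
move=> PQ; rewrite !num_iso_classesE; apply/subset_leq_card/fintype.subsetP => K.
by move=> /iso_classesP[g Pg ->]; apply/iso_classesP; exists g => //; exact: PQ.
Qed.

Lemma num_iso_classes_cover P Q :
  (num_iso_classes P <=
   num_iso_classes (fun g => P g /\ Q g) + num_iso_classes (fun g => P g /\ ~ Q g))%N.
Proof.
rewrite !num_iso_classesE; apply: leq_trans (leq_card_setU _ _).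
apply/subset_leq_card/fintype.subsetP => K /iso_classesP[g Pg ->{K}].
by rewrite finset.in_setU; apply/orP; have [Qg|Qg] := pselect (Q g); [left|right];
  apply/iso_classesP; exists g.
Qed.

(** Pairs (class, root) map onto the canonical trees: each tree is realised by a rooting of the
    representative of some class, and [children_ok_shape] makes the canonical shape chosen by [F]
    the only one. *)
Lemma size_trees_of_le :
  (size (trees_of n) <= n * num_iso_classes (@is_tree n))%N.
Proof.
pose rep (K : {set graph n}) : graph n := odflt (\matrix_(i, j) false) [pick h in K].
pose S (p : {set graph n} * 'I_n) : set rtree :=
  [set t | exists t', [/\ spans (rep p.1) t', root_label t' = p.2,
    shape t' = t & canonical t]]%classic.
pose F p := xget (LNode tt [::] : rtree) (S p).
rewrite num_iso_classesE mulnC -[X in (_ * X)%N]card_ord -cardsT -cardsX cardE.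
rewrite -(size_map F); apply: uniq_leq_size; first exact: trees_of_uniq.
move=> t; rewrite mem_trees_of => /andP[ct /eqP st].
have [g [t' [gT gt' sh]]] := realize_tree st.
have : rep (iso_class g) \in iso_class g.
  rewrite /rep; case: pickP => [//|/(_ g)].
  by rewrite inE graph_iso_refl.
rewrite inE => /graph_isoP[s Hs].
have spr := spans_lmap Hs gt'.
apply/mapP; exists (iso_class g, root_label (lmap s t')).
  by rewrite mem_enum finset.in_setX finset.in_setT andbT; apply/iso_classesP; exists g.
have sh' : shape (lmap s t') = t by rewrite shape_lmap.
have [u [spu ru <- cu]] : S (iso_class g, root_label (lmap s t'))
    (F (iso_class g, root_label (lmap s t'))).
  by apply: (@xgetI _ _ _ t); exists (lmap s t').
rewrite -sh' in ct *.
by apply: (children_ok_shape (children_ok_spans spr) (children_ok_spans spu)) => //.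
Qed.

(** A tree violating [P] has no limb, so its rooting at vertex 0 has a limb-free shape. The shape
    determines the class, hence limb-free shapes cover the bad classes. *)
Lemma num_iso_classes_bad P : (forall g, is_tree g -> has_limb g -> P g) ->
  (num_iso_classes (fun g => is_tree g /\ ~ P g) <= size (lftrees_of n))%N.
Proof.
move=> HP.
pose S (t : rtree) : set {set graph n} :=
  [set K | exists g t', [/\ K = iso_class g, spans g t' & shape t' = t]]%classic.
pose G t := xget finset.set0 (S t).
rewrite num_iso_classesE cardE -(size_map G).
apply: uniq_leq_size; first exact: enum_uniq.
move=> K; rewrite mem_enum => /iso_classesP[g [gT nP] ->{K}].
have n0 : (0 < n)%N by case: gT.
have [t [_ ct gt]] := spans_exists (Ordinal n0) gT.
apply/mapP; exists (shape t).
  rewrite mem_lftrees_of ct tsize_lmap (spans_tsize gt) eqxx !andbT.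
  apply: contraT => nlf; case: nP; apply: HP => //.
  have [_ [gsym girr] _ _] := gT.
  exact: (children_ok_limb gsym girr (children_ok_spans gt) nlf).
have [h [t' [-> ht' sh]]] : S (shape t) (G (shape t)).
  by apply: (@xgetI _ _ _ (iso_class g)); exists g, t.
by apply/iso_class_eq/(spans_iso gt ht'); rewrite sh.
Qed.

End IsoClasses.

(** * The proportion of trees with a limb *)

Section AlmostAll.
Variable R : realType.

(** For p between q and 1, Bernoulli's inequality n (p/q - 1) <= (p/q)^n absorbs the factor n. *)
Lemma natmul_geometric (q : R) : 0 < q < 1 -> exists C q', [/\ 0 <= C, 0 < q' < 1 &
  forall n, n%:R * q ^+ n <= C * q' ^+ n].
Proof.
move=> /andP[q0 q1]; pose p := (1 + q) / 2.
have pq : q < p by rewrite /p; lra.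
have p0 : 0 < p by rewrite /p; lra.
have e0 : 0 < p / q - 1 by rewrite subr_gt0 ltr_pdivlMr // mul1r.
exists (p / q - 1)^-1, p; split; first by rewrite invr_ge0 ltW.
  by rewrite p0 /= /p; lra.
move=> n; rewrite [X in _ <= X]mulrC ler_pdivlMr // mulrAC.
have bern : n%:R * (p / q - 1) <= (p / q) ^+ n.
  elim: n => [|n IH]; first by rewrite mul0r expr0.
  have : 0 <= (p / q - 1) * ((p / q) ^+ n - 1).
    by rewrite mulr_ge0 ?(ltW e0) // subr_ge0 exprn_ege1 // -subr_ge0 ltW.
  move: IH; rewrite -natr1 exprS; move: (p / q) (_ ^+ n) => r u; nra.
have -> : p ^+ n = (p / q) ^+ n * q ^+ n by rewrite -exprMn divfK // lt0r_neq0.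
by rewrite ler_pM2r ?exprn_gt0.
Qed.

Lemma almost_all_trees_limb (P : forall n, graph n -> Prop) :
  (forall n (g : graph n), is_tree g -> has_limb g -> P n g) -> almost_all_trees R P.
Proof.
move=> HP.
have [c [q [c0 q01 [n0 Hq]]]] := lftrees_of_ratio R.
have [C [q' [C0 /andP[q'0 q'1] HC]]] := natmul_geometric q01.
apply: (@squeeze_cvgr _ _ _ _ (fun n => 1 - C / c * q' ^+ n) (fun=> 1)).
- near=> n.
  have nn : (maxn n0 1 <= n)%N by near: n; exact: nbhs_infty_ge.
  move: nn; rewrite geq_max => /andP[nn0 n1].
  set good := num_iso_classes _; set all := num_iso_classes (@is_tree n).
  have rn := @size_trees_of_le n.
  have bad := @num_iso_classes_bad n (P n) (HP n).
  have cov := @num_iso_classes_cover n (@is_tree n) (P n).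
  have r1 : (1 <= size (trees_of n))%N.
    apply: leq_trans (size_trees_of_mono n1).
    suff : LNode tt [::] \in trees_of 1 by case: (trees_of 1).
    by rewrite mem_trees_of.
  have all0 : (0 < all)%N by move: (leq_trans r1 rn); rewrite muln_gt0 => /andP[].
  have all0' : 0 < all%:R :> R by rewrite ltr0n.
  apply/andP; split; last first.
    rewrite ler_pdivrMr // mul1r ler_nat; apply: num_iso_classes_mono.
    by move=> g [].
  rewrite ler_pdivlMr // mulrBl mul1r lerBlDr.
  apply: (@le_trans _ _ (good%:R + (size (lftrees_of n))%:R)).
    rewrite -natrD ler_nat; apply: leq_trans cov _.
    by rewrite leq_add2l.
  (* What remains is the chain c a_n <= q^n r_n <= q^n n [all] <= C q'^n [all]. *)
  rewrite lerD2l.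
  have := Hq n nn0; have := HC n.
  have : (size (trees_of n))%:R <= n%:R * all%:R :> R by rewrite -natrM ler_nat.
  move=> h1 h2 h3.
  have -> : C / c * q' ^+ n * all%:R = C * q' ^+ n * all%:R / c.
    by ring.
  rewrite ler_pdivlMr // mulrC; apply: le_trans h3 _.
  apply: (@le_trans _ _ (q ^+ n * (n%:R * all%:R))).
    by rewrite ler_wpM2l // exprn_ge0 // ltW //; case/andP: q01.
  rewrite mulrA [_ * n%:R]mulrC.
  apply: (@le_trans _ _ (C * q' ^+ n * all%:R)); first by rewrite ler_wpM2r.
  by rewrite mulrAC.
- rewrite -[X in (_ --> X)%classic]subr0 -(mulr0 (C / c)).
  apply: cvgB; first exact: cvg_cst.
  apply: cvgMr; apply: cvg_expr; rewrite ger0_norm // ltW //.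
- exact: cvg_cst.
Unshelve. all: by end_near. Qed.

End AlmostAll.

(** * Matrix exponential and state transfer *)

Section MatrixExponential.
Variables (R : realType) (C : numClosedFieldType) (n : nat).
Variables (f : {rmorphism R -> C}) (J : C).
Hypothesis fnorm : forall x, `|f x| = f `|x|.
Hypothesis fmono : forall x y, x < y -> f x < f y.
Hypothesis fpos : forall e, 0 < e -> exists2 x, 0 < x & f x = e.
Hypothesis JJ : J ^+ 2 = -1.

(** [f] and [J] model the embedding of the reals in [R[i]] and the imaginary unit. A positive
    epsilon of [C] is real by [fpos], so real estimates transfer. *)
Lemma cvg_rmorph (u : nat -> R) (l : R) : (u @ \oo --> l)%classic ->
  ((fun N => f (u N) : C) @ \oo --> (f l : C))%classic.
Proof.
move=> /cvgrPdist_lt ul; apply/cvgrPdist_lt => e /fpos[x x0 <-].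
by have := ul x x0; apply: filterS => N /fmono; rewrite -rmorphB fnorm.
Qed.

Lemma cvg_mx (u : nat -> 'M[C]_n) (L : 'M[C]_n) :
  (forall i j, ((fun N => u N i j : C) @ \oo --> (L i j : C))%classic) ->
  (u @ \oo --> L)%classic.
Proof.
move=> H; apply/cvg_ballP => e e0.
have : \forall N \near \oo%classic, forall i, forall j, ball (L i j) e (u N i j).
  apply: filter_forall => i; apply: filter_forall => j.
  by have /cvg_ballP := H i j; exact.
by apply: filterS => N HN; split.
Qed.

Lemma expmxE (M L : 'M[C]_n) :
  (forall i j, (series (fun k => (k`!%:R)^-1 * (M ^+ k) i j : C) @ \oo --> (L i j : C))%classic) ->
  expmx M = L.
Proof.
move=> H; apply: cvg_lim; first exact: norm_hausdorff.
apply: cvg_mx => i j.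
have -> : (fun N => series (fun k => (k`!%:R)^-1 *: M ^+ k) N i j) =
    series (fun k => (k`!%:R)^-1 * (M ^+ k) i j).
  by apply/funext => N; rewrite /series /= summxE; apply: eq_bigr => k _; rewrite mxE.
exact: H.
Qed.

Lemma cvg_series_sum_ord (F : 'I_n -> nat -> C) (L : 'I_n -> C) :
  (forall j, (series (F j) @ \oo --> L j)%classic) ->
  (series (fun k => \sum_j F j k) @ \oo --> \sum_j L j)%classic.
Proof.
move=> H.
have -> : series (fun k => \sum_j F j k) = fun N => \sum_j series (F j) N.
  by apply/funext => N; rewrite /series /= exchange_big.
by apply: cvg_big => //; first exact: add_continuous.
Qed.

(** Euler's formula term by term: the parity of [k] decides whether the power of [J] is real. *)
Lemma expi_coeff (t : R) k :
  (k`!%:R)^-1 * (J * f t) ^+ k = f (cos_coeff t k) + J * f (sin_coeff t k).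
Proof.
rewrite /cos_coeff /sin_coeff /= exprMn -{2}(odd_double_half k) exprD -mul2n exprM JJ.
rewrite !rmorphM !fmorphV !rmorphXn !rmorph_nat !rmorphN1.
case E : (odd k) => /=; rewrite ?mul0r ?mul1r ?expr1 ?expr0 ?mulr0 ?addr0 ?add0r; last by ring.
have -> : (k.-1./2 = k./2)%N by rewrite -(odd_double_half k) E add1n /= doubleK uphalf_double.
ring.
Qed.

Variables (A : 'M[R]_n) (t : R).
Hypothesis A1 : forall i j, `|A i j| <= 1.

Let M : 'M[C]_n := (J * f t) *: map_mx f A.

Lemma exprmxE k : M ^+ k = (J * f t) ^+ k *: map_mx f (A ^+ k).
Proof.
elim: k => [|k IH]; first by rewrite !expr0 scale1r map_mx1.
rewrite exprS IH -[LHS]/(M *m ((J * f t) ^+ k *: map_mx f (A ^+ k))).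
rewrite /M -scalemxAl -scalemxAr scalerA -exprS -map_mxM; congr (_ *: map_mx f _).
by rewrite exprS.
Qed.

(** Dominates the entries of the exponential series by the real series of exp(n|t|). *)
Lemma exprmx_bound k i j : `|(A ^+ k) i j| <= n%:R ^+ k.
Proof.
elim: k i => [|k IH] i; first by rewrite !expr0 mxE; case: (_ == _); rewrite /= ?normr1 ?normr0.
rewrite !exprS [_ * _]/(A *m _) mxE; apply: le_trans (ler_norm_sum _ _ _) _.
apply: (@le_trans _ _ (\sum_(l < n) n%:R ^+ k)).
  apply: ler_sum => l _; rewrite normrM -[X in _ <= X]mul1r.
  by apply: ler_pM => //; exact: IH.
by rewrite sumr_const card_ord mulr_natl.
Qed.

Lemma cvgn_coeff_mul (c : nat -> R) i j :
  (forall k, `|c k| <= `|t| ^+ k / k`!%:R) -> cvgn (series (fun k => c k * (A ^+ k) i j)).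
Proof.
move=> Hc; apply: normed_cvg.
apply: series_le_cvg; last exact: (is_cvg_series_exp_coeff (`|t| * n%:R)).
- by move=> k; exact: normr_ge0.
- by move=> k; apply: exp_coeff_ge0; rewrite mulr_ge0.
- move=> k /=; rewrite normrM /exp_coeff /= exprMn mulrAC.
  by apply: ler_pM => //; exact: exprmx_bound.
Qed.

(** Even powers of A fix u and odd ones send it to v, which sums to the cosine and sine. As [expmx]
    is a [limn], convergence must come first: [L] collects the entrywise limits. *)
Lemma expmx_mulmx (u v : 'cV[C]_n) :
  map_mx f A *m u = v -> map_mx f A *m v = u ->
  expmx M *m u = f (cos t) *: u + (J * f (sin t)) *: v.
Proof.
move=> Auv Avu.
have cosb k : `|cos_coeff t k| <= `|t| ^+ k / k`!%:R.
  rewrite /cos_coeff /= !normrM normfV !normr_nat !normrX normrN1 expr1n mulr1.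
  by case: odd; rewrite /= ?mul0r ?mul1r // divr_ge0 ?exprn_ge0.
have sinb k : `|sin_coeff t k| <= `|t| ^+ k / k`!%:R.
  rewrite /sin_coeff /= !normrM normfV !normr_nat !normrX normrN1 expr1n mulr1.
  by case: odd; rewrite /= ?mul0r ?mul1r // divr_ge0 ?exprn_ge0.
pose L : 'M[C]_n := \matrix_(i, j)
  (f (limn (series (fun k => cos_coeff t k * (A ^+ k) i j))) +
   J * f (limn (series (fun k => sin_coeff t k * (A ^+ k) i j)))).
have termE k : (k`!%:R)^-1 *: M ^+ k =
    f (cos_coeff t k) *: map_mx f (A ^+ k) + (J * f (sin_coeff t k)) *: map_mx f (A ^+ k).
  by rewrite exprmxE scalerA expi_coeff scalerDl.
have entry (a b : nat -> R) (la lb : R) :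
    (series a @ \oo --> la)%classic -> (series b @ \oo --> lb)%classic ->
    (series (fun k => f (a k) + J * f (b k) : C) @ \oo --> (f la + J * f lb : C))%classic.
  move=> ha hb.
  have -> : series (fun k => f (a k) + J * f (b k) : C) =
      (fun N => f (series a N) + J * f (series b N)).
    by apply/funext => N; rewrite /series /= big_split /= -mulr_sumr !rmorph_sum.
  apply: cvgD; first exact: cvg_rmorph.
  by apply: cvgMr; exact: cvg_rmorph.
have ML i j : (series (fun k => (k`!%:R)^-1 * (M ^+ k) i j : C) @ \oo --> (L i j : C))%classic.
  rewrite mxE; have -> : (fun k => (k`!%:R)^-1 * (M ^+ k) i j : C) = (fun k =>
     f (cos_coeff t k * (A ^+ k) i j) + J * f (sin_coeff t k * (A ^+ k) i j)).
    apply/funext => k; have := congr1 (fun B : 'M[C]_n => B i j) (termE k).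
    rewrite !mxE => ->.
    by rewrite [f (cos_coeff t k * _)]rmorphM [f (sin_coeff t k * _)]rmorphM mulrA.
  by apply: entry => //; exact: cvgn_coeff_mul.
rewrite (expmxE ML).
have powE k : map_mx f (A ^+ k) *m u = if odd k then v else u.
  elim: k => [|k IH]; first by rewrite expr0 map_mx1 mul1mx.
  rewrite exprS [_ * _]/(A *m _) map_mxM -mulmxA IH /=.
  by case: odd; rewrite /= ?Auv ?Avu.
apply/matrixP => i j; rewrite mxE [RHS]mxE [X in X + _]mxE [X in _ + X]mxE (ord1 j).
(* The coordinates of exp(M) u are computed twice as limits of one series, through [L] and through
   [powE]; uniqueness of limits concludes. *)
have lim1 : (series (fun k => \sum_l ((k`!%:R)^-1 * (M ^+ k) i l) * u l 0) @ \oo -->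
    \sum_l (L i l * u l 0))%classic.
  apply: cvg_series_sum_ord => l.
  have -> : series (fun k => (k`!%:R)^-1 * (M ^+ k) i l * u l 0) =
     fun N => series (fun k => (k`!%:R)^-1 * (M ^+ k) i l) N * u l 0.
    by apply/funext => N; rewrite /series /= mulr_suml.
  by apply: cvgMl; exact: ML.
have lim2 : (series (fun k => \sum_l ((k`!%:R)^-1 * (M ^+ k) i l) * u l 0) @ \oo -->
    f (cos t) * u i 0 + J * f (sin t) * v i 0)%classic.
  have -> : series (fun k => \sum_l ((k`!%:R)^-1 * (M ^+ k) i l) * u l 0) =
    fun N => f (series (cos_coeff t) N) * u i 0 + J * f (series (sin_coeff t) N) * v i 0.
    apply/funext => N; rewrite /series /= !rmorph_sum mulr_sumr !mulr_suml -big_split /=.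
    apply: eq_bigr => k _.
    have -> : \sum_l (k`!%:R)^-1 * (M ^+ k) i l * u l 0 = (((k`!%:R)^-1 *: M ^+ k) *m u) i 0.
      by rewrite !mxE; apply: eq_bigr => l _; rewrite !mxE.
    rewrite termE mulmxDl -!scalemxAl powE !mxE /cos_coeff /sin_coeff /=.
    by case: (odd k) => /=; rewrite !mul0r rmorph0 ?mulr0 !mul0r.
  apply: cvgD.
    by apply: cvgMl; apply: cvg_rmorph; rewrite unlock; exact: is_cvg_series_cos_coeff.
  apply: cvgMl; apply: cvgMr; apply: cvg_rmorph; rewrite unlock.
  exact: is_cvg_series_sin_coeff.
exact: (norm_cvg_unique lim1 lim2).
Qed.

End MatrixExponential.

(** * State transfer across a limb *)

Section LimbTransfer.
Variables (R : realType) (n : nat).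
Local Notation C := (R[i] : numClosedFieldType).
Implicit Types (A : 'M[R]_n) (g : graph n).

Lemma pst_half_pi A (u v : 'cV[R[i]]_n) (s : R[i]) :
  (forall i j, `|A i j| <= 1) ->
  map_mx (real_complex R) A *m u = v -> map_mx (real_complex R) A *m v = u ->
  perfect_state_transfer A (pi / 2) (s *: u) (s *: v).
Proof.
move=> A1 uv vu; exists 'i%C.
rewrite -scalemxAr scalerA ['i%C * s]mulrC -scalerA; congr (_ *: _).
have fnorm (x : R) : `|real_complex R x : C| = real_complex R `|x|.
  by rewrite normc_def /= expr0n addr0 sqrtr_sqr.
have fmono (x y : R) : x < y -> (real_complex R x : C) < real_complex R y.
  by rewrite ltcR.
have fpos (e : C) : 0 < e -> exists2 x : R, 0 < x & real_complex R x = e.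
  by case: e => [a b]; rewrite ltcE /= => /andP[/eqP -> a0]; exists a.
have E := @expmx_mulmx R C n (real_complex R) 'i%C fnorm fmono fpos (sqr_i R)
  A (pi / 2) A1 u v uv vu.
apply: etrans E _.
by rewrite cos_pihalf sin_pihalf rmorph0 rmorph1 scale0r add0r mulr1.
Qed.

Lemma mulmx_basis A (a : 'I_n) :
  map_mx (real_complex R) A *m basis_vec R a = \col_i (A i a)%:C%C.
Proof. by rewrite /basis_vec -colE; apply/matrixP => i j; rewrite !mxE. Qed.

Lemma adjmx_le1 g i j : `|adjmx R g i j| <= 1.
Proof. by rewrite mxE; case: (g i j); rewrite ?normr1 ?normr0 ?ler01. Qed.

Lemma set_edge_neg_le1 g x y i j : `|set_edge_neg (adjmx R g) x y i j| <= 1.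
Proof. by rewrite mxE; case: ifP => _; rewrite ?normrN1 // adjmx_le1. Qed.

Lemma not_collinear (a b : 'I_n) (s : R[i]) (u v : 'cV[R[i]]_n) :
  s != 0 -> u a 0 = 0 -> v a 0 = 1 -> ~ exists c, s *: v = c *: (s *: u).
Proof.
move=> s0 ua va [c] /matrixP/(_ a 0); rewrite !mxE ua va mulr1 !mulr0 => s0'.
by rewrite s0' eqxx in s0.
Qed.


Section Columns.
(** [al] and [be] are the weights of the edges w - b1 and b1 - b2; [si] is the relative sign of the
    initial state and [si * be] that of its image. *)
Variables (B : 'M[R]_n) (w a1 a2 b1 b2 : 'I_n) (al be si : R).
Hypothesis B1 : forall i j, `|B i j| <= 1.
Hypothesis Ba1 : forall i, B i a1 = (i == w)%:R + (i == a2)%:R.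
Hypothesis Ba2 : forall i, B i a2 = (i == a1)%:R.
Hypothesis Bb1 : forall i, B i b1 = al * (i == w)%:R + be * (i == b2)%:R.
Hypothesis Bb2 : forall i, B i b2 = be * (i == b1)%:R.
Hypotheses (sial : si * al = -1) (be2 : be * be = 1).

(* With [si * al = -1] the contributions of the two branches cancel at [w], so
   [B] swaps the two vectors. *)
Lemma limb_pst (s : R[i]) : perfect_state_transfer B (pi / 2)
  (s *: (basis_vec R a1 + si%:C%C *: basis_vec R b1))
  (s *: (basis_vec R a2 + (si * be)%:C%C *: basis_vec R b2)).
Proof.
apply: pst_half_pi => //; rewrite mulmxDr -scalemxAr !mulmx_basis;
  apply/matrixP => i j; rewrite (ord1 j) !mxE eqxx !andbT.
  rewrite Ba1 Bb1 -!(rmorph_nat (real_complex R)) -!rmorphM -!rmorphD; congr (_%:C)%C.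
  have -> : si * (al * (i == w)%:R + be * (i == b2)%:R) =
    (si * al) * (i == w)%:R + si * be * (i == b2)%:R by ring.
  by rewrite sial; ring.
rewrite Ba2 Bb2 -!(rmorph_nat (real_complex R)) -!rmorphM -!rmorphD; congr (_%:C)%C.
have -> : si * be * (be * (i == b1)%:R) = si * (be * be) * (i == b1)%:R by ring.
by rewrite be2 mulr1.
Qed.

End Columns.

Lemma sqrtC2_neq0 : (sqrtC 2 : R[i])^-1 != 0.
Proof. by rewrite invr_eq0 sqrtC_eq0 pnatr_eq0. Qed.

Lemma limb_transfers g : is_tree g -> has_limb g ->
  [/\ pair_state_transfer (adjmx R g) (pi / 2),
      exists x y, g x y /\ plus_state_transfer (set_edge_neg (adjmx R g) x y) (pi / 2) &
      exists x y, g x y /\ pair_plus_transfer (set_edge_neg (adjmx R g) x y) (pi / 2)].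
Proof.
move=> [_ [gsym _] _ _] [w [a1 [a2 [b1 [b2 [U ga1 ga2 gb1 gb2]]]]]].
move: U; rewrite /= !inE !negb_or !andbT.
case/and4P=> /and4P[/negbTE wa1 /negbTE wa2 /negbTE wb1 /negbTE wb2].
move=> /and3P[/negbTE a12 /negbTE a1b1 /negbTE a1b2] /andP[/negbTE a2b1 /negbTE a2b2] /negbTE b12.
have sy (x y : 'I_n) : (x == y) = false -> (y == x) = false by rewrite eq_sym.
(* All disequalities, in both orientations, as a single multirule. *)
have ne := ((wa1, wa2, wb1, wb2, a12), (a1b1, a1b2, a2b1, a2b2, b12),
  (sy _ _ wa1, sy _ _ wa2, sy _ _ wb1, sy _ _ wb2, sy _ _ a12),
  (sy _ _ a1b1, sy _ _ a1b2, sy _ _ a2b1, sy _ _ a2b2, sy _ _ b12)).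
have ca1 i : adjmx R g i a1 = (i == w)%:R + (i == a2)%:R.
  rewrite mxE gsym ga1; case: (eqVneq i w) => [->|_]; last by rewrite add0r.
  by rewrite wa2 addr0.
have ca2 i : adjmx R g i a2 = (i == a1)%:R by rewrite mxE gsym ga2.
have cb1 i : adjmx R g i b1 = (i == w)%:R + (i == b2)%:R.
  rewrite mxE gsym gb1; case: (eqVneq i w) => [->|_]; last by rewrite add0r.
  by rewrite wb2 addr0.
have cb2 i : adjmx R g i b2 = (i == b1)%:R by rewrite mxE gsym gb2.
have s0 := sqrtC2_neq0.
have bv (x y : 'I_n) : basis_vec R x y 0 = (y == x)%:R by rewrite mxE eqxx andbT.
split.
- exists ((sqrtC 2)^-1 *: (basis_vec R a1 - basis_vec R b1)),
    ((sqrtC 2)^-1 *: (basis_vec R a2 - basis_vec R b2)); split.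
  + by exists a1, b1; rewrite a1b1.
  + by exists a2, b2; rewrite a2b2.
  + apply: (not_collinear (a := a2)) => //.
      by rewrite mxE bv [X in _ + X]mxE bv !ne subr0.
    by rewrite mxE bv [X in _ + X]mxE bv eqxx !ne subr0.
  + have := @limb_pst (adjmx R g) w a1 a2 b1 b2 1 1 (-1) (@adjmx_le1 g) ca1 ca2.
    rewrite !mulr1 rmorphN1 !scaleN1r; apply => // i; rewrite !mul1r //.
- exists w, b1; split; first by rewrite gsym gb1 eqxx.
  exists ((sqrtC 2)^-1 *: (basis_vec R a1 + basis_vec R b1)),
    ((sqrtC 2)^-1 *: (basis_vec R a2 + basis_vec R b2)); split.
  + by exists a1, b1; rewrite a1b1.
  + by exists a2, b2; rewrite a2b2.
  + apply: (not_collinear (a := a2)) => //.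
      by rewrite mxE !bv !ne addr0.
    by rewrite mxE !bv eqxx !ne addr0.
  + have := @limb_pst (set_edge_neg (adjmx R g) w b1) w a1 a2 b1 b2 (-1) 1 1
      (@set_edge_neg_le1 g w b1).
    rewrite !mulr1 mul1r !scale1r; apply => // i.
    * by rewrite mxE !ne !andbF ca1.
    * by rewrite mxE !ne !andbF ca2.
    * rewrite mxE eqxx !ne andbT andbF orbF cb1 mul1r.
      by case: (eqVneq i w) => [->|_]; rewrite ?ne ?mulr1 ?mulr0 ?addr0 ?add0r.
    * by rewrite mxE !ne !andbF cb2 mul1r.
- exists b1, b2; split; first by rewrite gb1 eqxx orbT.
  exists ((sqrtC 2)^-1 *: (basis_vec R a1 - basis_vec R b1)),
    ((sqrtC 2)^-1 *: (basis_vec R a2 + basis_vec R b2)); split.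
  + by exists a1, b1; rewrite a1b1.
  + by exists a2, b2; rewrite a2b2.
  (* The negative weight [be] turns the initial sign [si = -1] into the final sign +1, so a pair
     state reaches a plus state. *)
  + have := @limb_pst (set_edge_neg (adjmx R g) b1 b2) w a1 a2 b1 b2 1 (-1) (-1)
      (@set_edge_neg_le1 g b1 b2).
    rewrite !mulr1 mulrNN mulr1 rmorphN1 scaleN1r scale1r; apply => // i.
    * by rewrite mxE !ne !andbF ca1.
    * by rewrite mxE !ne !andbF ca2.
    * rewrite mxE !ne eqxx andbT andbF cb1 mul1r mulN1r.
      by case: (eqVneq i b2) => [->|_]; rewrite ?ne ?oppr0 ?add0r ?addr0.
    * rewrite mxE eqxx !ne andbT andbF orbF cb2 mulN1r.
      by case: eqP => _; rewrite ?oppr0.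
Qed.

End LimbTransfer.

Theorem theorem5p9 (R : realType) :
  almost_all_trees R (fun (n : nat) (g : graph n) =>
    pair_state_transfer (adjmx R g) (pi / 2)) /\
  almost_all_trees R (fun (n : nat) (g : graph n) =>
    (exists x y : 'I_n,
       g x y /\ plus_state_transfer (set_edge_neg (adjmx R g) x y) (pi / 2)) /\
    (exists x y : 'I_n,
       g x y /\ pair_plus_transfer (set_edge_neg (adjmx R g) x y) (pi / 2))).
Proof.
split; apply: almost_all_trees_limb => n g gT gl.
  by have [] := limb_transfers R gT gl.
by have [] := limb_transfers R gT gl.
Qed.
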